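(* Let $\mu>0$ and let $p$ be fixed. For each sample size $n$ let $\theta:\mathcal X^n\to\mathbb R^p$ be a multivariate statistic with $0<\Delta_2(\theta;\mathcal X^n)<\infty$, let $\sigma_n=\Delta_2(\theta;\mathcal X^n)/\mu$, and let the mechanisms $M_{JS0}$, $M_{JS}$ and $M_{rJS}$ for sample size $n$ be defined with $\sigma=\sigma_n$ (so that they satisfy $\mu$-GDP), where $M_{rJS}$ uses any orthonormal basis matrix $U_\theta$. Let $S_1,S_2,\dots$ be any sequence of data sets with $S_n\in\mathcal X^n$. Assume that $p\ge4$, that $4\le d_\theta<p$ (for every $n$), and that as $n\to\infty$ $$\frac{\|\theta(S_n)\|_2}{\Delta_2(\theta;\mathcal X^n)}\to\infty,\qquad \frac{\|(I_p-\frac1p\mathbf 1_p\mathbf 1_p^\top)\theta(S_n)\|_2}{\Delta_2(\theta;\mathcal X^n)}\to\infty,\qquad \frac{\|(I_{d_\theta}-\frac1{d_\theta}\mathbf 1_{d_\theta}\mathbf 1_{d_\theta}^\top)U_\theta^\top\theta(S_n)\|_2}{\Delta_2(\theta;\mathcal X^n)}\to\infty .$$ Then $$\limsup_{n\to\infty}\frac{L_2(M_{rJS}(S_n))}{\sigma_n^2}<\liminf_{n\to\infty}\frac{L_2(M_{JS}(S_n))}{\sigma_n^2},$$ and the same inequality holds with $M_{JS}$ replaced by $M_{JS0}$.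
   Context: $\mathcal X$ is a sample space; $S,S'\in\mathcal X^n$ are neighbors ($S\sim S'$) if they differ in exactly one record. $\Delta_2(\theta;\mathcal X^n)=\sup_{S\sim S'}\|\theta(S)-\theta(S')\|_2$. The sensitivity space is $\mathcal S_\theta=\{\theta(S)-\theta(S'):S\sim S'\}$ and $d_\theta=\dim(\mathrm{span}(\mathcal S_\theta))$ (these, like $\theta$ and $U_\theta$, may depend on $n$). $\mathbf 1_d=(1,\dots,1)^\top\in\mathbb R^d$. Let $U_\theta$ and $U_1$ be matrices whose columns form orthonormal bases of $\mathrm{span}(\mathcal S_\theta)$ and of its orthogonal complement, respectively; $U_\theta$ does not depend on the data set $S$. For $\sigma>0$: $M_G(S)=\theta(S)+N_p(0,\sigma^2I_p)$; $M_r(S)=\theta(S)+N_p(0,\sigma^2U_\theta U_\theta^\top)$; $M_{JS0}(S)=m_0(M_G(S);\sigma)$; $M_{JS}(S)=m_a(M_G(S);\sigma)$; $M_{rJS}(S)=U_1U_1^\top\theta(S)+U_\theta\, m_a(U_\theta^\top M_r(S);\sigma)$. Here, for $x\in\mathbb R^d$, $m_0(x;\sigma)=\Big(1-\frac{(d-2)\sigma^2}{\|x\|_2^2}\Big)x$ and $m_a(x;\sigma)=\bar x\mathbf 1_d+\Big(1-\frac{(d-3)\sigma^2}{\|x_c\|_2^2}\Big)x_c$ with $\bar x=d^{-1}\mathbf 1_d^\top x$, $x_c=x-\bar x\mathbf 1_d$ ($d=p$ for $M_{JS0},M_{JS}$ and $d=d_\theta$ for $M_{rJS}$). $L_2(M(S))=\mathbb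 E\|M(S)-\theta(S)\|_2^2$, expectation over the randomness of $M$ with $S$ fixed. *)

(* Defs.v *)
From HB Require Import structures.
From mathcomp Require Import all_boot all_order all_algebra.
From mathcomp Require Import all_classical all_reals all_analysis.

Set Implicit Arguments.
Unset Strict Implicit.
Unset Printing Implicit Defensive.

Import Order.TTheory GRing.Theory Num.Theory.
Import numFieldNormedType.Exports.

Local Open Scope classical_set_scope.
Local Open Scope ring_scope.

(* Euclidean norm: the library norm `|x| of a matrix is the sup norm. *)
Definition l2norm (R : realType) (d : nat) (x : 'cV[R]_d) : R :=
  Num.sqrt (\sum_(i < d) x i 0 ^+ 2).

Definition ones (R : realType) (d : nat) : 'cV[R]_d := const_mx 1.

Definition centering (R : realType) (d : nat) : 'M[R]_d :=
  1%:M - d%:R^-1 *: (ones R d *m (ones R d)^T).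

Section LinearSpan.
Context (R : realType) (p : nat).
Implicit Types (A L : set 'cV[R]_p).

Definition linear_span A : set 'cV[R]_p :=
  [set v | exists (k : nat) (c : 'I_k -> R) (a : 'I_k -> 'cV[R]_p),
    (forall i, A (a i)) /\ v = \sum_(i < k) c i *: a i].

(* [linear_span A] as a subspace object; the default 0 is never used, by
   [mem_vspan]. *)
Definition vspan A : {vspace 'cV[R]_p} :=
  xget 0%VS [set V : {vspace 'cV[R]_p} | forall v, v \in V <-> linear_span A v].

Definition span_dim A : nat := \dim (vspan A).

Lemma linear_span_seq A (s : seq 'cV[R]_p) v :
  (forall x, x \in s -> A x) -> v \in span s -> linear_span A v.
Proof.
move=> sA vs.
have [c ->] : exists c : 'I_(size s) -> R, v = \sum_i c i *: (in_tuple s)`_i.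
  exists (fun i => coord (in_tuple s) i v).
  exact: (@coord_span _ _ _ (in_tuple s)).
exists (size s), c, (fun i => s`_i); split=> // i.
by apply: sA; exact: mem_nth.
Qed.

Lemma mem_vspan A v : v \in vspan A <-> linear_span A v.
Proof.
rewrite /vspan; case: xgetP => [V -> /(_ v)//|noV]; exfalso.
pose Q k := `[< exists s : seq 'cV[R]_p,
  (forall x, x \in s -> A x) /\ \dim (span s) = k >].
have exQ : exists k, Q k.
  by exists (\dim (span [::] : {vspace 'cV[R]_p})); apply/asboolP; exists [::].
have ubQ k : Q k -> (k <= \dim {:'cV[R]_p})%N.
  by move=> /asboolP[s [_ <-]]; exact/dimvS/subvf.
have [k /asboolP[s [sA dims]] maxk] := ex_maxnP exQ ubQ.
apply: (noV (span s)) => u; split; first exact: linear_span_seq.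
case=> m [c [a [aA ->]]]; apply: memv_suml => i _; apply: memvZ.
have sub : (span s <= span (a i :: s))%VS by rewrite span_cons addvSr.
have : (span s == span (a i :: s))%VS.
  rewrite eqEdim sub dims; apply: maxk; apply/asboolP.
  by exists (a i :: s); split=> // x; rewrite inE => /predU1P[->|/sA].
by move=> /eqP ->; rewrite memv_span// mem_head.
Qed.

Definition orthogonal_complement L : set 'cV[R]_p :=
  [set v | forall u, L u -> (u^T *m v) 0 0 = 0].

(* The columns of U are an orthonormal basis of the subspace L. *)
Definition orthonormal_basis (k : nat) (U : 'M[R]_(p, k)) L : Prop :=
  U^T *m U = 1%:M /\ linear_span (range (fun j : 'I_k => col j U)) = L.

End LinearSpan.

Section Sensitivity.
Context (R : realType) (X : Type) (n p : nat).
Implicit Types (S : n.-tuple X) (theta : n.-tuple X -> 'cV[R]_p).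

Definition neighbors S S' : Prop :=
  exists! i : 'I_n, tnth S i <> tnth S' i.

Definition sensitivity_space theta : set 'cV[R]_p :=
  [set v | exists S S', neighbors S S' /\ v = theta S - theta S'].

Definition sensitivity theta : \bar R :=
  ereal_sup [set r | exists S S',
    neighbors S S' /\ r = (l2norm (theta S - theta S'))%:E].

Definition sens_dim theta : nat := span_dim (sensitivity_space theta).

End Sensitivity.

(* The law N(m, v) with variance v >= 0; N(m, 0) is the point mass at m.
   [normal_prob] takes the standard deviation and is not the point mass when
   that is 0. *)
Definition normal_law (R : realType) (m v : R) (B : set R) : \bar R :=
  if v == 0 then \d_m B else normal_prob m (Num.sqrt v) B.

(* Z ~ N_p(m, Sigma): every linear combination a^T Z of the coordinates is
   univariate normal, with mean a^T m and variance a^T Sigma a.  Sigma may be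
   singular. *)
Definition multivariate_normal (R : realType) (d : measure_display)
    (T : measurableType d) (P : probability T R) (p : nat)
    (Z : T -> 'cV[R]_p) (m : 'cV[R]_p) (Sigma : 'M[R]_p) : Prop :=
  forall a : 'cV[R]_p,
    measurable_fun [set: T] (fun w => (a^T *m Z w) 0 0) /\
    forall B : set R, measurable B ->
      P [set w | B ((a^T *m Z w) 0 0)] =
      normal_law ((a^T *m m) 0 0) ((a^T *m Sigma *m a) 0 0) B.

(* x / 0 = 0, so both maps are total; their value where the denominator
   vanishes is irrelevant under a nondegenerate normal law. *)
Definition m_0 (R : realType) (d : nat) (sigma : R) (x : 'cV[R]_d) : 'cV[R]_d :=
  (1 - (d%:R - 2) * sigma ^+ 2 / l2norm x ^+ 2) *: x.

Definition m_a (R : realType) (d : nat) (sigma : R) (x : 'cV[R]_d) : 'cV[R]_d :=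
  let xbar := d%:R^-1 * ((ones R d)^T *m x) 0 0 in
  let xc := x - xbar *: ones R d in
  xbar *: ones R d + (1 - (d%:R - 3) * sigma ^+ 2 / l2norm xc ^+ 2) *: xc.

Section Mechanisms.
Context (R : realType) (X : Type) (n p : nat).
Context (d : measure_display) (T : measurableType d) (P : probability T R).
Implicit Types (theta : n.-tuple X -> 'cV[R]_p)
  (M : n.-tuple X -> T -> 'cV[R]_p) (sigma : R).

(* M(S) = theta(S) + N_p(0, Sigma) for every S. *)
Definition normal_mechanism theta (Sigma : 'M[R]_p) M : Prop :=
  forall S, multivariate_normal P (fun w => M S w - theta S) 0 Sigma.

Definition M_JS0 sigma (M_G : n.-tuple X -> T -> 'cV[R]_p) :
    n.-tuple X -> T -> 'cV[R]_p :=
  fun S w => m_0 sigma (M_G S w).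

Definition M_JS sigma (M_G : n.-tuple X -> T -> 'cV[R]_p) :
    n.-tuple X -> T -> 'cV[R]_p :=
  fun S w => m_a sigma (M_G S w).

Definition M_rJS (k l : nat) theta (U : 'M[R]_(p, k)) (U1 : 'M[R]_(p, l)) sigma
    (M_r : n.-tuple X -> T -> 'cV[R]_p) : n.-tuple X -> T -> 'cV[R]_p :=
  fun S w => U1 *m U1^T *m theta S + U *m m_a sigma (U^T *m M_r S w).

Definition L2_risk theta M (S : n.-tuple X) : \bar R :=
  ('E_P[fun w => (l2norm (M S w - theta S) ^+ 2)%R])%E.

End Mechanisms.

(* Main.v *)
Require Import Defs.
From HB Require Import structures.
From mathcomp Require Import all_boot all_order all_algebra.
From mathcomp Require Import ring lra.
From mathcomp Require Import all_classical all_reals all_analysis.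
From mathcomp Require Import measurable_realfun.

Import Order.TTheory GRing.Theory Num.Theory.
Import numFieldNormedType.Exports.

Local Open Scope classical_set_scope.
Local Open Scope ring_scope.

(* Idea: write x = theta + Z with Z Gaussian.  Each shrinkage estimator has the
   form x - h with h = (c sigma^2 / |Qx|^2) Qx, where Q is the identity or the
   centering projection.  The inequalities
     |Z - h|^2 <= (1 + eta) |Z|^2 + (1 + 1/eta) |h|^2   and
     |Z|^2 <= (1 + eta) |Z - h|^2 + (1 + 1/eta) |h|^2
   reduce everything to E |h|^2 = o(sigma^2), that is, to
   E [sigma^2 / |Qx|^2] -> 0; the normalized risks then tend to the dimension of
   the noise, which is p for M_JS and M_JS0, and d_theta <= p - 1 for M_rJS.

   As a normal vector is only known through its one-dimensional projections,
   the small-ball estimate behind this inverse moment is obtained by Fourier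
   analysis.  Since exp (- y^2 / 2) is the expectation of cos (t y) for a
   standard normal t, three applications of Fubini's theorem bound
   E exp (- a^2 |Y|^2 / 2) by a^-3 for three orthonormal coordinates Y of x,
   uniformly in theta.  The function 1 / |Y|^2 is dominated near 0 by the dyadic
   sum of 8 4^k exp (- 4^k |Y|^2 / 2), whose expectation converges precisely
   because 3 > 2. *)

(** * Gaussian integrals *)

Lemma norm_cos_le1 {R : realType} (x : R) : `|cos x| <= 1.
Proof. by rewrite ler_norml cos_geN1 cos_le1. Qed.

Lemma measurable_funcos {R : realType} d (T : measurableType d) (f : T -> R) :
  measurable_fun [set: T] f -> measurable_fun [set: T] (fun w => cos (f w)).
Proof.
apply: measurableT_comp.
by apply: continuous_measurable_fun; exact: continuous_cos.
Qed.

Section GaussianIntegrals.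
Context {R : realType}.
Local Notation mu := (@lebesgue_measure R).
Local Notation phi := (@normal_pdf R 0 1).
Local Notation peak := (@normal_peak R 1).

(** The bound on [x * F x] makes [F] vanish at both infinities, so the integrals of [f] over growing
    symmetric intervals tend to 0; dominated convergence identifies their limit. This stands in for
    integration by parts on the whole line. *)
Lemma Rintegral_derivative_eq0 (F f : R -> R) (C : R) :
  continuous f -> (forall x : R, is_derive x 1 F (f x)) ->
  (forall x, `|x * F x| <= C) ->
  mu.-integrable [set: R] (EFin \o f) ->
  \int[mu]_x f x = 0.
Proof.
move=> cf dF FC intf.
have mf : measurable_fun [set: R] (EFin \o f) by case/integrableP: intf.
(* The half-width [n.+1] keeps the interval nondegenerate at n = 0 and allows division by it in
   [bI]. *)
pose D n : set R := `[- (n.+1%:R : R), n.+1%:R]%classic.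
pose fn n : R -> \bar R := (EFin \o f) \_ (D n).
have mfn n : measurable_fun [set: R] (fn n).
  by apply/(measurable_restrictT _ _).1; [exact: measurable_itv|exact: measurable_funTS].
have cvgfn x : fn n x @[n --> \oo] --> (f x)%:E.
  apply: cvg_near_cst; near=> n.
  rewrite /fn patchE mem_set// /D /= in_itv/= -ler_norml (@le_trans _ _ n%:R) ?ler_nat//.
  by near: n; exact: nbhs_infty_ger.
have lefn x n : (`|fn n x| <= `|(f x)%:E|)%E.
  by rewrite /fn patchE; case: ifP => //= _; rewrite ?normr0 lee_fin.
have [||_ _ cvgI] := @dominated_convergence _ _ _ mu setT measurableT fn (EFin \o f)
   (fun x => `|(f x)%:E|%E) mfn mf _ (integrable_abse intf) _.
- by apply: aeW => x _; exact: cvgfn.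
- by apply: aeW => x n _; exact: lefn.
have I n : (\int[mu]_x fn n x = (F n.+1%:R - F (- n.+1%:R))%:E)%E.
  rewrite /fn -integral_mkcond.
  rewrite (@continuous_FTC2 _ f F)//.
  - by rewrite gtrN.
  - exact: continuous_subspaceT.
  - have cF : continuous F.
      by move=> x; apply/differentiable_continuous/derivable1_diffP.
    split=> [x _||].
    + exact: ex_derive.
    + exact/cvg_at_right_filter/cF.
    + exact/cvg_at_left_filter/cF.
  - by move=> x _; rewrite derive1E; apply: derive_val.
have bI n : `|F n.+1%:R - F (- n.+1%:R)| <= C *+ 2 * n.+1%:R^-1.
  rewrite ler_pdivlMr// mulr2n (le_trans _ (lerD (FC n.+1%:R) (FC (- n.+1%:R))))//.
  rewrite !normrM normrN -mulrDr mulrC (ger0_norm (ler0n _ _)) ler_wpM2l//.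
  exact: ler_normB.
have F0 : (F n.+1%:R - F (- n.+1%:R)) @[n --> \oo] --> 0.
  apply: norm_cvg0; apply: (@squeeze_cvgr _ _ _ _ (fun=> 0) (fun n => C *+ 2 * n.+1%:R^-1)).
  - by near=> n; rewrite normr_ge0 bI.
  - exact: cvg_cst.
  - by rewrite -(mulr0 (C *+ 2)); apply: cvgMr; exact: cvg_harmonic.
have cvgI0 : [sequence (\int[mu]_x fn n x)%E]_n @ \oo --> 0%:E.
  rewrite (_ : [sequence _]_n = fun n => (F n.+1%:R - F (- n.+1%:R))%:E).
    by apply: cvg_EFin => //; exact: nearW.
  by apply/funext => n; rewrite /= I.
by rewrite /Rintegral -(cvg_unique _ cvgI0 cvgI).
Unshelve. all: by end_near.
Qed.

Lemma std_normal_pdfE x : phi x = peak * expR (- (x ^+ 2 / 2)).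
Proof.
by rewrite normal_pdfE ?oner_eq0//= /normal_fun subr0 expr1n mulNr.
Qed.

Lemma is_derive_std_normal_pdf (x : R) : is_derive x 1 phi (- (x * phi x)).
Proof.
rewrite (_ : @normal_pdf R 0 1 = fun y => peak * expR (- (y ^+ 2 / 2))); last first.
  by apply/funext => y; exact: std_normal_pdfE.
apply: is_derive_eq.
rewrite /GRing.scale/=.
by field.
Qed.

(** Half of the exponent absorbs [x ^+ 2], by 1 + y <= exp y at y = x^2 / 4. The other half is, up
    to a constant, the density of variance 2, which is how integrability follows next. *)
Lemma sqr_std_normal_pdf_le x : x ^+ 2 * phi x <= 4 * peak * expR (- (x ^+ 2 / 4)).
Proof.
rewrite std_normal_pdfE.
have -> : expR (- (x ^+ 2 / 2)) = expR (- (x ^+ 2 / 4)) * expR (- (x ^+ 2 / 4)).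
  by rewrite -expRD; congr expR; field.
have H : x ^+ 2 * expR (- (x ^+ 2 / 4)) <= 4.
  rewrite expRN -ler_pdivlMr ?invr_gt0 ?expR_gt0// invrK.
  have := expR_ge1Dx (x ^+ 2 / 4); lra.
rewrite (_ : _ * _ = (x ^+ 2 * expR (- (x ^+ 2 / 4))) *
  (peak * expR (- (x ^+ 2 / 4)))); last by ring.
by rewrite -[4 * _ * _]mulrA ler_wpM2r// mulr_ge0 ?expR_ge0 ?normal_peak_ge0.
Qed.

Lemma integrable_sqr_std_normal_pdf :
  mu.-integrable [set: R] (EFin \o (fun x => x ^+ 2 * phi x)).
Proof.
set c := @normal_peak R (Num.sqrt 2).
have s0 : Num.sqrt 2 != 0 :> R by rewrite gt_eqF// sqrtr_gt0.
have := integrable_normal_pdf 0 (Num.sqrt 2 : R).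
move=> /(integrableZl measurableT (4 * peak / c)).
apply: le_integrable => //.
  apply/measurable_EFinP/measurable_funM; first exact: measurable_funX.
  exact: measurable_normal_pdf.
move=> x _ /=; rewrite lee_fin [leRHS]ger0_norm; last first.
  by rewrite !mulr_ge0 ?normal_pdf_ge0 ?invr_ge0 ?normal_peak_ge0.
rewrite ger0_norm; last by apply: mulr_ge0; [exact: sqr_ge0|exact: normal_pdf_ge0].
apply: le_trans (sqr_std_normal_pdf_le x) _.
rewrite normal_pdfE//= /normal_fun subr0 sqr_sqrtr// -/c -[_ *+ 2]mulr_natr -natrM.
rewrite mulrA divfK ?mulNr// gt_eqF// normal_peak_gt0//.
Qed.

Lemma std_normal_pdf_bound x : x ^+ 2 * phi x <= 4 * peak.
Proof.
apply: le_trans (sqr_std_normal_pdf_le x) _; rewrite ler_piMr ?mulr_ge0 ?normal_peak_ge0//.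
by rewrite -[leRHS]expR0 ler_expR oppr_le0 mulr_ge0 ?sqr_ge0.
Qed.

Lemma integrable_std_normal_pdfM (h : R -> R) (C : R) :
  measurable_fun [set: R] h -> (forall x, `|h x| <= C * (1 + x ^+ 2)) ->
  mu.-integrable [set: R] (EFin \o (fun x => h x * phi x)).
Proof.
move=> mh hC.
have := integrableD measurableT (integrable_normal_pdf 0 1) integrable_sqr_std_normal_pdf.
move=> /(integrableZl measurableT C).
apply: le_integrable => //.
  by apply/measurable_EFinP/measurable_funM => //; exact: measurable_normal_pdf.
move=> x _ /=; rewrite lee_fin.
rewrite -[X in X + _]mul1r -mulrDl mulrA !normrM ler_wpM2r// (le_trans (hC x))//.
by rewrite -normrM ler_norm.
Qed.

Lemma continuous_std_normal_pdf : continuous phi.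
Proof. exact/continuous_normal_pdf/oner_neq0. Qed.

(** The derivative of x phi(x) is phi(x) - x^2 phi(x), so the second moment equals the total
    mass. *)
Lemma Rintegral_sqr_std_normal_pdf : \int[mu]_x (x ^+ 2 * phi x) = 1.
Proof.
have : \int[mu]_x (phi x - x ^+ 2 * phi x) = 0.
  apply: (@Rintegral_derivative_eq0 (fun x => x * phi x) _ (4 * peak)).
  - move=> x; apply: cvgB; first exact: continuous_std_normal_pdf.
    by apply: cvgM; [exact: exprn_continuous|exact: continuous_std_normal_pdf].
  - move=> x; have := is_derive_std_normal_pdf x => dphi.
    by apply: is_derive_eq; rewrite /GRing.scale/=; ring.
  - move=> x; rewrite mulrA -expr2 ger0_norm ?std_normal_pdf_bound//.
    by apply: mulr_ge0; [exact: sqr_ge0|exact: normal_pdf_ge0].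
  - rewrite (_ : (fun _ => _) = fun x => (1 - x ^+ 2) * phi x); last first.
      by apply/funext => x; ring.
    apply: (@integrable_std_normal_pdfM _ 1).
      by apply: measurable_funB => //; exact: measurable_funX.
    by move=> x; rewrite mul1r (le_trans (ler_normB _ _))// normr1 ger0_norm ?sqr_ge0.
rewrite RintegralB//; first last.
- exact: integrable_sqr_std_normal_pdf.
- exact: integrable_normal_pdf.
by rewrite {1}/Rintegral integral_normal_pdf => /subr0_eq.
Qed.

Let cosphi (c : R) t x := cos (c + t * x) * phi x.

Let dcosphi (c t x : R) :
  is_derive t 1 (fun t => cosphi c t x) (- (sin (c + t * x) * x) * phi x).
Proof. by apply: is_derive_eq; rewrite /GRing.scale/=; ring. Qed.

Let dsinphi (c t x : R) :
  is_derive x 1 (fun x => sin (c + t * x) * phi x)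
    (t * cosphi c t x - sin (c + t * x) * x * phi x).
Proof.
have dphi := is_derive_std_normal_pdf x.
by apply: is_derive_eq; rewrite /GRing.scale/= /cosphi; ring.
Qed.

Let continuous_affine (c t : R) : continuous (fun x : R => c + t * x).
Proof. by move=> x; apply: cvgD; [exact: cvg_cst|apply: cvgMr; exact: cvg_id]. Qed.

Let continuous_cos_affine (c t : R) : continuous (fun x : R => cos (c + t * x)).
Proof.
move=> x; apply: (@cvg_comp _ _ _ (fun x => c + t * x) cos).
  exact: continuous_affine.
exact: continuous_cos.
Qed.

Let continuous_sin_affine (c t : R) : continuous (fun x : R => sin (c + t * x)).
Proof.
move=> x; apply: (@cvg_comp _ _ _ (fun x => c + t * x) sin).
  exact: continuous_affine.
exact: continuous_sin.
Qed.

Let norm_le_sqr (x : R) : `|x| <= 1 + x ^+ 2.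
Proof.
rewrite -(real_normK (num_real x)).
by have := sqr_ge0 (`|x| - 1); have := normr_ge0 x; nra.
Qed.

Let norm_sin_le1 (x : R) : `|sin x| <= 1.
Proof. by rewrite ler_norml sin_geN1 sin_le1. Qed.

Let integrable_cosphi c t : mu.-integrable [set: R] (EFin \o cosphi c t).
Proof.
apply: (@integrable_std_normal_pdfM _ 1).
  apply: continuous_measurable_fun; exact: continuous_cos_affine.
by move=> x; rewrite mul1r (le_trans (norm_cos_le1 _))// lerDl sqr_ge0.
Qed.

Let integrable_sinphi c t :
  mu.-integrable [set: R] (EFin \o (fun x => sin (c + t * x) * x * phi x)).
Proof.
apply: (@integrable_std_normal_pdfM _ 1).
  by apply: measurable_funM => //; apply: continuous_measurable_fun; exact: continuous_sin_affine.
by move=> x; rewrite mul1r normrM (le_trans _ (norm_le_sqr x))// ler_piMl.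
Qed.

(** The difference of the two integrands is, up to sign, the derivative of sin (c + t x) phi(x). *)
Let Rintegral_sinphi c t :
  \int[mu]_x (sin (c + t * x) * x * phi x) = t * \int[mu]_x cosphi c t x.
Proof.
rewrite -(RintegralZl _ measurableT (integrable_cosphi c t)).
apply/esym/eqP; rewrite -subr_eq0.
have intZ : mu.-integrable [set: R] (EFin \o (fun x => t * cosphi c t x)).
  have := integrableZl measurableT t (integrable_cosphi c t).
  by apply: eq_integrable.
rewrite -RintegralB//.
apply/eqP.
apply: (@Rintegral_derivative_eq0 (fun x => sin (c + t * x) * phi x) _ (peak + 4 * peak)).
- move=> x; apply: cvgB.
    apply: cvgMr; apply: cvgM; first exact: continuous_cos_affine.
    exact: continuous_std_normal_pdf.
  apply: cvgM; last exact: continuous_std_normal_pdf.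
  by apply: cvgM; [exact: continuous_sin_affine|exact: cvg_id].
- exact: dsinphi.
- move=> x; rewrite mulrCA normrM (le_trans (ler_piMl _ (norm_sin_le1 _)))//.
  rewrite normrM (ger0_norm (normal_pdf_ge0 _ _ _)).
  apply: le_trans (ler_wpM2r (normal_pdf_ge0 _ _ _) (norm_le_sqr x)) _.
  by rewrite mulrDl mul1r lerD ?normal_pdf_ub ?oner_eq0 ?std_normal_pdf_bound.
- by have := integrableB measurableT intZ (integrable_sinphi c t); apply: eq_integrable.
Qed.

(* [F t] below solves F' = - t F, by Gaussian integration by parts. *)
Lemma std_normal_charfun c t :
  \int[mu]_x (cos (c + t * x) * phi x) = cos c * expR (- (t ^+ 2 / 2)).
Proof.
pose F t := \int[mu]_x cosphi c t x.
have dF (s : R) : is_derive s 1 F (- (s * F s)).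
  have sI : (`]s - 1, s + 1[)%classic s by rewrite /= in_itv/= gtrBl ltrDl ltr01.
  (* Since |sin| <= 1, the function |x| phi(x) dominates the derivative in the parameter, whatever
     its value. *)
  have intG : mu.-integrable [set: R] (EFin \o (fun x => `|x| * phi x)).
    apply: (@integrable_std_normal_pdfM _ 1) => [|x]; first by apply: normr_measurable.
    by rewrite mul1r normr_id.
  have G0 x : 0 <= `|x| * phi x by rewrite mulr_ge0 ?normal_pdf_ge0.
  have partialE u x : partial1of2 (cosphi c) u x = - (sin (c + u * x) * x) * phi x.
    by rewrite /partial1of2 derive1E; apply: derive_val.
  have intF u : (`]s - 1, s + 1[)%classic u -> mu.-integrable [set: R] (EFin \o cosphi c u).
    by move=> _; exact: integrable_cosphi.
  have dF u x : (`]s - 1, s + 1[)%classic u -> [set: R] x -> derivable ((cosphi c)^~ x) u 1.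
    by move=> _ _; exact: ex_derive.
  have Gub u x : (`]s - 1, s + 1[)%classic u -> [set: R] x ->
      `|partial1of2 (cosphi c) u x| <= `|x| * phi x.
    move=> _ _; rewrite partialE normrM (ger0_norm (normal_pdf_ge0 _ _ _)).
    rewrite ler_wpM2r ?normal_pdf_ge0//.
    by rewrite normrN normrM ler_piMl.
  apply: DeriveDef.
    exact: (@derivable_under_integral _ _ _ mu _ _ measurableT _ _ _ sI intF dF _ G0 intG Gub).
  rewrite -derive1E (differentiation_under_integral measurableT sI intF dF G0 intG Gub).
  under eq_Rintegral do rewrite partialE mulNr -mulN1r.
  by rewrite RintegralZl// Rintegral_sinphi mulN1r.
(* The integrating factor of F' = - t F makes [G] constant, equal to its value cos c at 0. *)
pose G t := F t * expR (t ^+ 2 / 2).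
have dG (s : R) : is_derive s 1 G 0.
  by apply: is_derive_eq; rewrite /GRing.scale/=; field.
have G0 : G 0 = cos c.
  rewrite /G /F expr0n/= mul0r expR0 mulr1 /cosphi.
  under eq_Rintegral do rewrite mul0r addr0.
  rewrite RintegralZl//; last exact: integrable_normal_pdf.
  by rewrite {1}/Rintegral integral_normal_pdf mulr1.
rewrite -G0 -(is_derive_0_is_cst t 0 dG) /G expRN mulfK//.
by rewrite gt_eqF ?expR_gt0.
Qed.

End GaussianIntegrals.

(** * ** Expectations under a standard normal law *)

Lemma bounded_integrable_probability {R : realType} d (T : measurableType d)
    (P : probability T R) (f : T -> R) (C : R) :
  measurable_fun [set: T] f -> (forall w, `|f w| <= C) ->
  P.-integrable [set: T] (EFin \o f).
Proof.
move=> mf fC; apply: measurable_bounded_integrable => //.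
  by apply: le_lt_trans (probability_le1 P measurableT) _; rewrite ltry.
by exists C; split => [|M CM w _ /=]; rewrite ?num_real// (le_trans (fC w))// ltW.
Qed.

Section NormalProb.
Context {R : realType}.
Local Notation mu := (@lebesgue_measure R).

(** The Radon-Nikodym derivative of the normal law agrees almost everywhere with [normal_pdf], as
    both have the same integral over every measurable set. *)
Lemma ge0_integral_normal_prob (m s : R) (f : R -> \bar R) :
  (forall x, 0 <= f x)%E -> measurable_fun [set: R] f ->
  (\int[normal_prob m s]_x f x = \int[mu]_x (f x * (normal_pdf m s x)%:E))%E.
Proof.
move=> f0 mf.
have dom := normal_prob_dominates m s.
rewrite -(Radon_Nikodym_SigmaFinite.change_of_variables dom)//.
apply: ae_eq_integral => //.
- apply: emeasurable_funM => //; apply: measurable_int.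
  exact: (Radon_Nikodym_SigmaFinite.f_integrable dom).
- by apply: emeasurable_funM => //; apply/measurable_EFinP; exact: measurable_normal_pdf.
- apply: ae_eqe_mul2l; apply: integral_ae_eq => //.
  + exact: (Radon_Nikodym_SigmaFinite.f_integrable dom).
  + by apply/measurable_EFinP; exact: measurable_normal_pdf.
  + by move=> E _ mE; rewrite -(Radon_Nikodym_SigmaFinite.f_integral dom).
Qed.

Context d (T : measurableType d) (P : probability T R) (X : T -> R).
Hypothesis mX : measurable_fun [set: T] X.
Hypothesis PX : forall B, measurable B -> P (X @^-1` B) = normal_prob 0 1 B.

Lemma ge0_expectation_std_normal (f : R -> R) :
  (forall x, 0 <= f x) -> measurable_fun [set: R] f ->
  (\int[P]_w (f (X w))%:E = \int[mu]_x (f x * normal_pdf 0 1 x)%:E)%E.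
Proof.
move=> f0 mf.
pose X' : {mfun T >-> measurableTypeR R} :=
  HB.pack (X : T -> measurableTypeR R) (isMeasurableFun.Build _ _ T (measurableTypeR R) X mX).
transitivity (\int[distribution P X']_x (f x)%:E)%E.
  rewrite ge0_integral_distribution//; first exact/measurable_EFinP.
transitivity (\int[normal_prob 0 1]_x (f x)%:E)%E.
  apply: (@eq_measure_integral _ _ _ _ (normal_prob 0 1) (distribution P X')) => A mA _; exact: PX.
rewrite ge0_integral_normal_prob//; last exact/measurable_EFinP.
Qed.

Lemma expectation_sqr_std_normal : (\int[P]_w ((X w) ^+ 2)%:E = 1)%E.
Proof.
rewrite (@ge0_expectation_std_normal (fun x => x ^+ 2)).
- rewrite -[LHS]fineK; last first.
    exact: (integrable_fin_num measurableT integrable_sqr_std_normal_pdf).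
  by congr EFin; exact: Rintegral_sqr_std_normal_pdf.
- by move=> x; exact: sqr_ge0.
- exact: measurable_funX.
Qed.

Lemma Rexpectation_cos_std_normal (c t : R) :
  \int[P]_w cos (c + t * X w) = cos c * expR (- (t ^+ 2 / 2)).
Proof.
have mc : measurable_fun [set: R] (fun x => cos (c + t * x)).
  apply: measurable_funcos.
  by apply: measurable_funD => //; exact: measurable_funM.
have mcX : measurable_fun [set: T] (fun w => cos (c + t * X w)).
  exact: (measurableT_comp mc mX).
have intX : P.-integrable [set: T] (EFin \o (fun w => cos (c + t * X w))).
  apply: (@bounded_integrable_probability _ _ _ _ _ 1) => // w.
  exact: norm_cos_le1.
have int1 : P.-integrable [set: T] (EFin \o (fun=> 1)).
  by apply: finite_measure_integrable_cst.
have intphi : mu.-integrable [set: R] (EFin \o (fun x => cos (c + t * x) * normal_pdf 0 1 x)).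
  apply: (@integrable_std_normal_pdfM _ _ 1) => // x.
  rewrite mul1r (@le_trans _ _ 1)//; last by rewrite lerDl sqr_ge0.
  exact: norm_cos_le1.
(* The transfer to the density is available for nonnegative functions, so 1 + cos is transferred and
   the 1 is cancelled afterwards. *)
have : \int[P]_w (1 + cos (c + t * X w)) =
    \int[mu]_x (normal_pdf 0 1 x + cos (c + t * x) * normal_pdf 0 1 x).
  rewrite /Rintegral (@ge0_expectation_std_normal (fun x => 1 + cos (c + t * x))).
  - by congr fine; apply: eq_integral => x _; rewrite mulrDl mul1r.
  - by move=> x; rewrite -lerBlDl sub0r cos_geN1.
  - exact: measurable_funD.
rewrite RintegralD// RintegralD//; last exact: integrable_normal_pdf.
rewrite std_normal_charfun {3}/Rintegral integral_normal_pdf/= Rintegral_cst//.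
by rewrite [X in fine X]probability_setT mulr1 => /addrI.
Qed.

End NormalProb.

(** * Laplace transform of the squared norm *)

Section GaussianKernel.
Context {R : realType} d (T : measurableType d) (P : probability T R).
Implicit Types (f V Y : T -> R) (a c : R).
Local Notation gamma := (@normal_prob R 0 1).
(** The kernel times the standard density is at most 1 / a times the density of N(0, 1 / a^2): the
    peak of the latter is a times the standard peak, and the leftover factor exp (- t^2 / 2) is at
    most 1. *)
Lemma Rintegral_gauss_kernel_le a : 0 < a ->
  \int[gamma]_t expR (- ((a * t) ^+ 2 / 2)) <= a^-1.
Proof.
move=> a0.
have mE : measurable_fun [set: R] (fun t => expR (- ((a * t) ^+ 2 / 2))).
  apply: measurableT_comp => //; apply: measurableT_comp => //.
  by apply: measurable_funM => //; apply: measurable_funX; exact: measurable_funM.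
have peakV : normal_peak a^-1 = a * normal_peak 1 :> R.
  rewrite /normal_peak expr1n exprVn mul1r -[in LHS]mulrnAr sqrtrM ?invr_ge0 ?sqr_ge0//.
  by rewrite sqrtrV ?sqr_ge0// sqrtr_sqr gtr0_norm// invfM invrK.
have kE (t : R) : expR (- ((a * t) ^+ 2 / 2)) * normal_pdf 0 1 t <= a^-1 * normal_pdf 0 a^-1 t.
  rewrite std_normal_pdfE normal_pdfE ?invr_neq0 ?gt_eqF//= peakV /normal_fun subr0.
  rewrite !mulrA mulVf ?gt_eqF// mul1r.
  rewrite (_ : - t ^+ 2 / (a^-1 ^+ 2 *+ 2) = - ((a * t) ^+ 2 / 2)); last first.
    by field; rewrite gt_eqF.
  rewrite [X in X * _ <= _]mulrC ler_piMr ?mulr_ge0 ?normal_peak_ge0 ?expR_ge0//.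
  by rewrite -[leRHS]expR0 ler_expR oppr_le0 mulr_ge0 ?sqr_ge0.
have I : (\int[gamma]_t (expR (- ((a * t) ^+ 2 / 2)))%:E <= a^-1%:E)%E.
  rewrite ge0_integral_normal_prob//; last exact/measurable_EFinP.
  apply: (@le_trans _ _ (\int[lebesgue_measure]_t (a^-1%:E * (normal_pdf 0 a^-1 t)%:E)))%E.
    apply: ge0_le_integral => //.
    - by move=> x _; rewrite lee_fin mulr_ge0 ?expR_ge0 ?normal_pdf_ge0.
    - by apply/measurable_EFinP/measurable_funM => //; exact: measurable_normal_pdf.
    - by apply/measurable_EFinP/measurable_funM => //; exact: measurable_normal_pdf.
    - by move=> x _; rewrite lee_fin.
  rewrite ge0_integralZl//; first by rewrite integral_normal_pdf mule1.
  - by apply/measurable_EFinP; exact: measurable_normal_pdf.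
  - by move=> x _; rewrite lee_fin normal_pdf_ge0.
  - by rewrite lee_fin invr_ge0 ltW.
have I0 : (0 <= \int[gamma]_t (expR (- ((a * t) ^+ 2 / 2)))%:E)%E.
  by apply: integral_ge0 => x _; rewrite lee_fin expR_ge0.
by rewrite -lee_fin fineK// ge0_fin_numE// (le_lt_trans I) ?ltry.
Qed.

(** For fixed w, averaging cos (c + V + a t Y) over a standard normal t gives the kernel in Y times
    cos (c + V); Fubini applies to an integrand bounded by 1. For iteration, [f] holds the kernels
    of the coordinates already treated and [V] a linear form in those still to come. *)
Lemma Rintegral_gauss_kernel_fubini f V Y c a :
  measurable_fun [set: T] f -> measurable_fun [set: T] V -> measurable_fun [set: T] Y ->
  (forall w, `|f w| <= 1) ->
  measurable_fun [set: R] (fun t => \int[P]_w (f w * cos (c + V w + a * t * Y w))) /\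
  \int[P]_w (f w * expR (- ((a * Y w) ^+ 2 / 2)) * cos (c + V w)) =
  \int[gamma]_t \int[P]_w (f w * cos (c + V w + a * t * Y w)).
Proof.
move=> mf mV mY f1.
pose g (z : T * measurableTypeR R) : \bar R := (f z.1 * cos (c + V z.1 + a * z.2 * Y z.1))%:E.
have mg : measurable_fun [set: T * measurableTypeR R] g.
  apply/measurable_EFinP; apply: measurable_funM; first exact: measurableT_comp.
  apply: measurable_funcos.
  apply: measurable_funD; first by apply: measurable_funD => //; exact: measurableT_comp.
  apply: measurable_funM; last exact: measurableT_comp.
  apply: measurable_funM => //.
have g1 z : (`|g z| <= 1%:E)%E.
  rewrite /g lee_fin normrM -[leRHS]mulr1 ler_pM//.
  exact: norm_cos_le1.
have ig : (P \x gamma)%E.-integrable [set: T * measurableTypeR R] g.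
  apply/integrableP; split=> //.
  apply: (@le_lt_trans _ _ (\int[P \x gamma]_x (cst 1 x)))%E.
    by apply: ge0_le_integral => //; exact: measurableT_comp.
  rewrite integral_cst// mul1e.
  have := product_measure1E P gamma measurableT measurableT.
  rewrite setXTT => PgE.
  suff: (P [set: T] * gamma [set: R] < +oo)%E by rewrite -PgE.
  rewrite (_ : P setT = 1%E); last exact: probability_setT.
  by rewrite mul1e (le_lt_trans (probability_le1 gamma measurableT))// ltry.
have int1 w : gamma.-integrable [set: R]
    (EFin \o (fun t => f w * cos (c + V w + a * t * Y w))).
  apply: (@bounded_integrable_probability _ _ _ _ _ 1); last first.
    by move=> t; have := g1 (w, t); rewrite lee_fin.
  apply: measurable_funM => //.
  apply: measurable_funcos.
  by apply: measurable_funD => //; apply: measurable_funM => //; exact: measurable_funM.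
have int2 t : P.-integrable [set: T] (EFin \o (fun w => f w * cos (c + V w + a * t * Y w))).
  apply: (@bounded_integrable_probability _ _ _ _ _ 1); last first.
    by move=> w; have := g1 (w, t); rewrite lee_fin.
  apply: measurable_funM => //.
  apply: measurable_funcos.
  by apply: measurable_funD => //; [exact: measurable_funD|exact: measurable_funM].
split.
  exact: (measurableT_comp (fine_measurable measurableT) (measurable_fubini_G ig)).
have := Fubini ig.
rewrite /Rintegral => FE; transitivity (fine (\int[P]_x (\int[gamma]_y g (x, y)))%E); last first.
  rewrite FE; congr fine; apply: eq_integral => t _.
  by rewrite fineK//; exact: (integrable_fin_num measurableT (int2 t)).
congr fine; apply: eq_integral => w _.
rewrite -[RHS]fineK; last exact: (integrable_fin_num measurableT (int1 w)).
congr EFin.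
transitivity (\int[gamma]_t (f w * cos (c + V w + (a * Y w) * t))); last first.
  by rewrite /Rintegral; congr fine; apply: eq_integral => t _; rewrite /g/= mulrAC.
rewrite RintegralZl//.
  by rewrite (@Rexpectation_cos_std_normal _ _ _ gamma id)// mulrA mulrAC.
apply: (@bounded_integrable_probability _ _ _ _ _ 1) => [|t].
  apply: measurable_funcos.
  by apply: measurable_funD => //; exact: measurable_funM.
exact: norm_cos_le1.
Qed.

(** The assumed decay in t is itself a Gaussian kernel, and its average over t yields the factor 1 /
    a. *)
Lemma Rintegral_gauss_kernel_bound f V Y c a K : 0 < a -> 0 <= K ->
  measurable_fun [set: T] f -> measurable_fun [set: T] V -> measurable_fun [set: T] Y ->
  (forall w, `|f w| <= 1) ->
  (forall t, `|\int[P]_w (f w * cos (c + V w + a * t * Y w))| <=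
    K * expR (- ((a * t) ^+ 2 / 2))) ->
  `|\int[P]_w (f w * expR (- ((a * Y w) ^+ 2 / 2)) * cos (c + V w))| <= K / a.
Proof.
move=> a0 K0 mf mV mY f1 HK.
have [mI ->] := Rintegral_gauss_kernel_fubini _ _ _ c a mf mV mY f1.
have mE : measurable_fun [set: R] (fun t => expR (- ((a * t) ^+ 2 / 2))).
  apply: measurableT_comp => //; apply: measurableT_comp => //.
  by apply: measurable_funM => //; apply: measurable_funX; exact: measurable_funM.
have intE : gamma.-integrable [set: R] (EFin \o (fun t => expR (- ((a * t) ^+ 2 / 2)))).
  apply: (@bounded_integrable_probability _ _ _ _ _ 1) => // t.
  by rewrite ger0_norm ?expR_ge0// -[leRHS]expR0 ler_expR oppr_le0 mulr_ge0 ?sqr_ge0.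
have E1 t : expR (- ((a * t) ^+ 2 / 2)) <= 1.
  by rewrite -[leRHS]expR0 ler_expR oppr_le0 mulr_ge0 ?sqr_ge0.
apply: (@le_trans _ _ (\int[gamma]_t (K * expR (- ((a * t) ^+ 2 / 2))))); last first.
  by rewrite RintegralZl// ler_wpM2l// Rintegral_gauss_kernel_le.
have intI : gamma.-integrable [set: R]
    (EFin \o (fun t => \int[P]_w (f w * cos (c + V w + a * t * Y w)))).
  apply: (@bounded_integrable_probability _ _ _ _ _ K) => // t.
  by rewrite (le_trans (HK t))// ler_piMr.
apply: le_trans (le_normr_Rintegral measurableT intI) _.
apply: le_Rintegral => //.
- have := integrable_abse intI; by apply: eq_integrable.
- by have := integrableZl measurableT K intE; apply: eq_integrable.
Qed.

Variables Y1 Y2 Y3 : T -> R.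
Hypothesis mY1 : measurable_fun [set: T] Y1.
Hypothesis mY2 : measurable_fun [set: T] Y2.
Hypothesis mY3 : measurable_fun [set: T] Y3.
(** The characteristic function is compared with that of three independent standard normals. The
    phase [c] is arbitrary so that it can absorb the means, which makes the estimates uniform in
    them. *)
Hypothesis charY : forall u1 u2 u3 c,
  `|\int[P]_w cos (c + (u1 * Y1 w + u2 * Y2 w + u3 * Y3 w))| <=
  expR (- ((u1 ^+ 2 + u2 ^+ 2 + u3 ^+ 2) / 2)).

Let k1 a (Y : T -> R) w := expR (- ((a * Y w) ^+ 2 / 2)).

Let k1_ge0 a Y w : 0 <= k1 a Y w. Proof. exact: expR_ge0. Qed.

Let k1_le1 a Y w : k1 a Y w <= 1.
Proof. by rewrite /k1 -[leRHS]expR0 ler_expR oppr_le0 mulr_ge0 ?sqr_ge0. Qed.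

Let measurable_k1 a Y : measurable_fun [set: T] Y -> measurable_fun [set: T] (k1 a Y).
Proof.
move=> mY; apply: measurableT_comp => //; apply: measurableT_comp => //.
by apply: measurable_funM => //; apply: measurable_funX; exact: measurable_funM.
Qed.

(* Averaging out one Gaussian kernel bounds it by 1 / a and lets the cosine of
   the remaining coordinates keep its own decay. *)
Lemma gauss_kernel3_le a : 0 < a ->
  \int[P]_w expR (- (a ^+ 2 * (Y1 w ^+ 2 + Y2 w ^+ 2 + Y3 w ^+ 2) / 2)) <= a^-1 ^+ 3.
Proof.
move=> a0.
rewrite (_ : \int[P]_w _ = \int[P]_w (k1 a Y1 w * k1 a Y2 w * k1 a Y3 w)); last first.
  by apply: eq_Rintegral => w _; rewrite -!expRD; congr expR; field.
have E0 x : 0 <= expR x :> R by exact: expR_ge0.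
have b1 u2 u3 c : `|\int[P]_w (k1 a Y1 w * cos (c + (u2 * Y2 w + u3 * Y3 w)))| <=
    expR (- ((u2 ^+ 2 + u3 ^+ 2) / 2)) / a.
  under eq_Rintegral do rewrite -[k1 _ _ _]mul1r.
  apply: (@Rintegral_gauss_kernel_bound (fun=> 1) (fun w => u2 * Y2 w + u3 * Y3 w) Y1) => //.
  - by apply: measurable_funD; exact: measurable_funM.
  - by move=> _; rewrite normr1.
  move=> t.
  have e w : c + (u2 * Y2 w + u3 * Y3 w) + a * t * Y1 w =
      c + (a * t * Y1 w + u2 * Y2 w + u3 * Y3 w) by ring.
  under eq_Rintegral do rewrite mul1r e.
  apply: le_trans (charY _ _ _ _) _.
  by rewrite -expRD ler_expR le_eqVlt; apply/orP; left; apply/eqP; field.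
have b2 u3 c : `|\int[P]_w (k1 a Y1 w * k1 a Y2 w * cos (c + u3 * Y3 w))| <=
    expR (- (u3 ^+ 2 / 2)) / a / a.
  apply: (@Rintegral_gauss_kernel_bound (k1 a Y1) (fun w => u3 * Y3 w) Y2) => //.
  - by rewrite divr_ge0// ltW.
  - exact: measurable_k1.
  - exact: measurable_funM.
  - by move=> w; rewrite ger0_norm.
  move=> t.
  have e w : c + u3 * Y3 w + a * t * Y2 w = c + (a * t * Y2 w + u3 * Y3 w) by ring.
  under eq_Rintegral do rewrite e.
  apply: le_trans (b1 _ _ _) _.
  rewrite mulrAC -expRD ler_pM2r ?invr_gt0//.
  by rewrite ler_expR le_eqVlt; apply/orP; left; apply/eqP; field.
have b3 c : `|\int[P]_w (k1 a Y1 w * k1 a Y2 w * k1 a Y3 w * cos (c + 0))| <=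
    a^-1 / a / a.
  apply: (@Rintegral_gauss_kernel_bound (fun w => k1 a Y1 w * k1 a Y2 w) (fun w => 0) Y3) => //.
  - by rewrite divr_ge0 ?invr_ge0// ltW.
  - by apply: measurable_funM; exact: measurable_k1.
  - by move=> w; rewrite ger0_norm ?mulr_ge0// mulr_ile1.
  move=> t; under eq_Rintegral do rewrite addr0.
  apply: le_trans (b2 _ _) _.
  by rewrite -mulrA mulrC [X in _ <= X * _]mulrC -invfM.
have := b3 0; rewrite addr0 cos0.
under eq_Rintegral do rewrite mulr1.
rewrite !exprS expr0 mulr1 => H.
by apply: le_trans (ler_norm _) _; rewrite mulrA.
Qed.

End GaussianKernel.

(** * Inverse second moment *)

Section InverseMoment.
Context {R : realType} d (T : measurableType d) (P : probability T R).

(** This selects the single term of the dyadic sum that dominates a large value of 1 / D. *)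
Lemma exists_pow4_bracket (x : R) (k1 : nat) : 4 ^+ k1 < x ->
  exists j, 4 ^+ (k1 + j) <= x < 4 ^+ (k1 + j).+1.
Proof.
move=> kx.
have [n xn] : exists n, x < 4 ^+ n.
  have [n xn] : exists n, x < n%:R :> R by exists (Num.truncn x).+1; exact: truncnS_gt.
  exists n; apply: lt_le_trans xn _.
  by rewrite -natrX ler_nat ltnW// ltn_expl.
have exn : exists n, x < 4 ^+ n by exists n.
case: (ex_minnP exn) => -[|k] xk mink.
  by move: kx; rewrite ltNge => /negP[]; rewrite (le_trans (ltW xk))// expr0 exprn_ege1// ler1n.
have k1k : (k1 <= k)%N.
  rewrite leqNgt; apply/negP => kk1.
  have := lt_trans kx xk; rewrite ltr_eXn2l ?ltr1n// ltnS leqNgt.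
  by rewrite kk1.
exists (k - k1)%N; rewrite subnKC// xk andbT leNgt.
by apply/negP => /mink; rewrite ltnn.
Qed.

Lemma measurable_funV (f : T -> R) : measurable_fun [set: T] f ->
  (forall w, 0 <= f w) -> measurable_fun [set: T] (fun w => (f w)^-1).
Proof.
(* At 0 the power with exponent -1 is 0, in agreement with 1 / 0 = 0. *)
move=> mf f0; rewrite (_ : (fun _ => _) = fun w => f w `^ (-1)).
  exact: (measurableT_comp (measurable_powR _)).
by apply/funext => w; rewrite powR_inv1.
Qed.

Variables Y1 Y2 Y3 D N : T -> R.
Hypothesis mY1 : measurable_fun [set: T] Y1.
Hypothesis mY2 : measurable_fun [set: T] Y2.
Hypothesis mY3 : measurable_fun [set: T] Y3.
Hypothesis mD : measurable_fun [set: T] D.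
Hypothesis mN : measurable_fun [set: T] N.
Hypothesis charY : forall u1 u2 u3 c,
  `|\int[P]_w cos (c + (u1 * Y1 w + u2 * Y2 w + u3 * Y3 w))| <=
  expR (- ((u1 ^+ 2 + u2 ^+ 2 + u3 ^+ 2) / 2)).
Let W w := Y1 w ^+ 2 + Y2 w ^+ 2 + Y3 w ^+ 2.
Hypothesis WD : forall w, W w <= D w.
Hypothesis N0 : forall w, 0 <= N w.
Let W0 w : 0 <= W w. Proof. by rewrite !addr_ge0 ?sqr_ge0. Qed.

Let D0 w : 0 <= D w. Proof. exact: le_trans (WD w). Qed.

Let K (k1 j : nat) w : R := 8 * 4 ^+ (k1 + j) * expR (- ((2 ^+ (k1 + j)) ^+ 2 * W w / 2)).
Let K0 k1 j w : 0 <= K k1 j w.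
Proof. by rewrite /K mulr_ge0 ?expR_ge0// mulr_ge0// exprn_ge0. Qed.

(* When D is neither large (first term) nor small (dyadic sum), the noise N must
   be of the order of m2. *)
Let inverse_pointwise m2 eps k1 w : 0 < eps -> 4 / eps <= m2 ->
  m2 <= 2 * (D w + N w) ->
  (((D w)^-1)%:E <= (eps + 4 ^+ k1.+1 / m2 * N w)%:E + \sum_(0 <= j <oo) (K k1 j w)%:E)%E.
Proof.
move=> eps0 m2eps m2DN.
have m20 : 0 < m2 by apply: lt_le_trans m2eps; rewrite divr_gt0.
have S0 : (0 <= \sum_(0 <= j <oo) (K k1 j w)%:E)%E.
  by apply: nneseries_ge0 => j _ _; rewrite lee_fin.
have A0 : 0 <= 4 ^+ k1.+1 / m2 * N w.
  by rewrite mulr_ge0// divr_ge0 ?exprn_ge0// ltW.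
have [Deps|Deps] := leP (D w)^-1 eps.
  apply: (@le_trans _ _ ((eps + 4 ^+ k1.+1 / m2 * N w)%:E)); last by rewrite leeDl.
  by rewrite lee_fin (le_trans Deps)// lerDl.
have Dgt0 : 0 < D w by rewrite -invr_gt0 (lt_trans eps0).
have [Dk1|Dk1] := leP (D w)^-1 (4 ^+ k1).
  apply: (@le_trans _ _ ((eps + 4 ^+ k1.+1 / m2 * N w)%:E)); last by rewrite leeDl.
  (* Here D < 1 / eps <= m2 / 4, so m2 <= 2 (D + N) leaves m2 <= 4 N. *)
  have : D w < eps^-1 by rewrite -[D w]invrK ltf_pV2 ?posrE ?invr_gt0.
  move=> Deps'; have N4 : m2 <= 4 * N w by move: m2eps m2DN; lra.
  rewrite lee_fin (le_trans Dk1)//; apply: ler_wpDl; first exact: ltW.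
  rewrite exprSr (_ : _ * _ = 4 ^+ k1 * (4 * N w / m2)); last by ring.
  by rewrite ler_peMr ?exprn_ge0// ler_pdivlMr// mul1r.
have [j /andP[jD Dj]] := exists_pow4_bracket _ _ Dk1.
apply: (@le_trans _ _ (K k1 j w)%:E).
  rewrite lee_fin /K; set a := 4 ^+ _ in jD Dj *.
  rewrite (le_trans (ltW Dj))// exprS -/a.
  rewrite (_ : (2 ^+ _) ^+ 2 = a); last by rewrite exprAC -natrX.
  (* From a W <= a D <= 1 the exponential is at least 1/2, so the term 8 a exp (- a W / 2) is at
     least 4 a, which exceeds 1 / D. *)
  have aW : a * W w <= 1.
    rewrite (@le_trans _ _ (a * D w))// ?ler_wpM2l ?exprn_ge0//.
    by rewrite -ler_pdivlMr// mul1r.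
  have : 1 - a * W w / 2 <= expR (- (a * W w / 2)) := expR_ge1Dx _.
  have a0 : 0 < a by rewrite exprn_gt0.
  by nra.
apply: (@le_trans _ _ (\sum_(0 <= j <oo) (K k1 j w)%:E)%E); last first.
  by rewrite leeDr// lee_fin addr_ge0// ltW.
apply: le_trans (nneseries_lim_ge j.+1 _); last by move=> i _ _; rewrite lee_fin.
by rewrite big_nat_recr//= leeDr// sume_ge0// => i _; rewrite lee_fin.
Qed.

(** The three terms come from large D, from large noise, and from the dyadic sum: its j-th term has
    expectation at most 8 * 4^k / 2^(3k) = 8 / 2^k with k = k1 + j, and these bounds add up to 16 /
    2^k1. *)
Lemma inverse_moment_le m2 eps k1 (n : R) : 0 < eps -> 4 / eps <= m2 ->
  (forall w, m2 <= 2 * (D w + N w)) ->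
  (\int[P]_w (N w)%:E = n%:E)%E ->
  (\int[P]_w ((D w)^-1)%:E <= (eps + 4 ^+ k1.+1 / m2 * n + 16 / 2 ^+ k1)%:E)%E.
Proof.
move=> eps0 m2eps m2DN EN.
have m20 : 0 < m2 by apply: lt_le_trans m2eps; rewrite divr_gt0.
have b0 : 0 <= 4 ^+ k1.+1 / m2 by rewrite divr_ge0 ?exprn_ge0// ltW.
have mW : measurable_fun [set: T] W.
  by apply: measurable_funD; [apply: measurable_funD|]; exact: measurable_funX.
have mE j : measurable_fun [set: T] (fun w => expR (- ((2 ^+ (k1 + j)) ^+ 2 * W w / 2))).
  apply: measurableT_comp => //; apply: measurableT_comp => //.
  by apply: measurable_funM => //; exact: measurable_funM.
have mK j : measurable_fun [set: T] (fun w => (K k1 j w)%:E).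
  by apply/measurable_EFinP; exact: measurable_funM.
have mS : measurable_fun [set: T] (fun w => (\sum_(0 <= j <oo) (K k1 j w)%:E)%E).
  by apply: ge0_emeasurable_sum => // j w _ _; rewrite lee_fin.
have S0 w : (0 <= \sum_(0 <= j <oo) (K k1 j w)%:E)%E.
  by apply: nneseries_ge0 => j _ _; rewrite lee_fin.
apply: (@le_trans _ _ (\int[P]_w ((eps + 4 ^+ k1.+1 / m2 * N w)%:E +
    \sum_(0 <= j <oo) (K k1 j w)%:E)))%E.
  apply: ge0_le_integral => //.
  - by move=> w _; rewrite lee_fin invr_ge0.
  - by apply/measurable_EFinP; exact: measurable_funV.
  - apply: emeasurable_funD => //; apply/measurable_EFinP.
    by apply: measurable_funD => //; exact: measurable_funM.
  - by move=> w _; exact: inverse_pointwise.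
rewrite ge0_integralD//; last 2 first.
- by move=> w _; rewrite lee_fin; apply: addr_ge0; [exact: ltW|exact: mulr_ge0].
- apply/measurable_EFinP.
  by apply: measurable_funD => //; exact: measurable_funM.
rewrite EFinD; apply: leeD.
  under eq_integral do rewrite EFinD EFinM.
  rewrite ge0_integralD//; last 3 first.
  - by move=> w _; rewrite lee_fin ltW.
  - by move=> w _; rewrite mule_ge0// lee_fin.
  - by apply/measurable_EFinP; exact: measurable_funM.
  rewrite ge0_integralZl//; last 2 first.
  - exact/measurable_EFinP.
  - by move=> w _; rewrite lee_fin.
  have -> : (\int[P]__ eps%:E = eps%:E)%E.
    by rewrite integral_cst// -[RHS]mule1; congr (_ * _)%E; exact: probability_setT.
  by rewrite EN -EFinM -EFinD.
rewrite integral_nneseries//; last by move=> j w _; rewrite lee_fin.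
apply: le_trans (epsilon_trick0 xpredT _); last by rewrite divr_ge0 ?exprn_ge0.
apply: lee_nneseries => [j _ _|j _].
  by apply: integral_ge0 => w _; rewrite lee_fin.
have a0 : 0 < 2 ^+ (k1 + j) :> R by rewrite exprn_gt0.
have intE : P.-integrable [set: T]
    (EFin \o (fun w => expR (- ((2 ^+ (k1 + j)) ^+ 2 * W w / 2)))).
  apply: (@bounded_integrable_probability _ _ _ _ _ 1) => // w.
  by rewrite ger0_norm ?expR_ge0// -[leRHS]expR0 ler_expR oppr_le0 !mulr_ge0// sqr_ge0.
rewrite [leLHS](_ : _ = (8 * 4 ^+ (k1 + j) *
    \int[P]_w expR (- ((2 ^+ (k1 + j)) ^+ 2 * W w / 2)))%:E); last first.
  rewrite -RintegralZl// /Rintegral fineK//.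
  have := integrableZl measurableT (8 * 4 ^+ (k1 + j)) intE.
  by move=> /(integrable_fin_num measurableT).
rewrite lee_fin.
apply: (@le_trans _ _ (8 * 4 ^+ (k1 + j) * (2 ^+ (k1 + j))^-1 ^+ 3)).
  rewrite ler_wpM2l ?mulr_ge0 ?exprn_ge0//.
  by apply: gauss_kernel3_le.
rewrite natrX (exprS 2 j).
rewrite (_ : 4 ^+ (k1 + j) = (2 ^+ k1) ^+ 2 * (2 ^+ j) ^+ 2 :> R); last first.
  by rewrite -exprMn -exprD [RHS]exprAC; congr (_ ^+ _); rewrite -natrX.
rewrite exprD; set x := 2 ^+ k1; set y := 2 ^+ j.
have x0 : x != 0 by rewrite expf_neq0.
have y0 : y != 0 by rewrite expf_neq0.
rewrite (_ : 8 * _ * _ = 16 / x / (2 * y))//.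
by field; rewrite x0 y0.
Qed.

End InverseMoment.

(** First [k1] makes the dyadic tail at most eps / 3, then [M] makes the noise term at most eps / 3.
    The threshold is chosen before the probability space, because each sample size brings its own
    space. *)
Lemma inverse_moment_small (R : realType) (eps : R) (p : nat) : 0 < eps ->
  exists M : R, forall d (T : measurableType d) (P : probability T R)
      (Y1 Y2 Y3 D N : T -> R) (m2 n : R),
    measurable_fun [set: T] Y1 -> measurable_fun [set: T] Y2 ->
    measurable_fun [set: T] Y3 -> measurable_fun [set: T] D ->
    measurable_fun [set: T] N ->
    (forall u1 u2 u3 c,
      `|\int[P]_w cos (c + (u1 * Y1 w + u2 * Y2 w + u3 * Y3 w))| <=
      expR (- ((u1 ^+ 2 + u2 ^+ 2 + u3 ^+ 2) / 2))) ->
    (forall w, Y1 w ^+ 2 + Y2 w ^+ 2 + Y3 w ^+ 2 <= D w) ->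
    (forall w, 0 <= N w) ->
    (forall w, m2 <= 2 * (D w + N w)) ->
    (\int[P]_w (N w)%:E = n%:E)%E -> 0 <= n <= p%:R -> M <= m2 ->
    (\int[P]_w ((D w)^-1)%:E <= eps%:E)%E.
Proof.
move=> eps0.
have e30 : 0 < eps / 3 by rewrite divr_gt0.
have [k1 hk1] : exists k1, 16 / 2 ^+ k1 <= eps / 3.
  have [k hk] : exists k, 16 / (eps / 3) < k%:R.
    by exists (Num.truncn (16 / (eps / 3))).+1; exact: truncnS_gt.
  exists k; rewrite ler_pdivrMr ?exprn_gt0// mulrC -ler_pdivrMr//.
  by rewrite (le_trans (ltW hk))// -natrX ler_nat ltnW// ltn_expl.
pose B := 4 ^+ k1.+1 * p%:R / (eps / 3).
exists (Num.max (4 / (eps / 3)) B) => d T P Y1 Y2 Y3 D N m2 n.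
move=> mY1 mY2 mY3 mD mN cY WD N0 mDN EN /andP[n0 np].
rewrite ge_max => /andP[M1 M2].
have m20 : 0 < m2 by apply: lt_le_trans M1; rewrite divr_gt0.
apply: (@le_trans _ _ ((eps / 3 + 4 ^+ k1.+1 / m2 * n + 16 / 2 ^+ k1)%:E)).
  exact: (@inverse_moment_le _ _ _ _ Y1 Y2 Y3 D N).
rewrite lee_fin (@le_trans _ _ (eps / 3 + eps / 3 + eps / 3)) ?lerD//; last lra.
rewrite mulrAC ler_pdivrMr// [leRHS]mulrC -ler_pdivrMr//.
apply: le_trans M2; rewrite /B ler_pM2r ?invr_gt0// ler_wpM2l// exprn_ge0//.
Qed.

(** * ** Euclidean norms, centering and the shrinkage maps *)

Section SquaredNorm.
Context {R : realType}.

Lemma l2norm_sqr k (x : 'cV[R]_k) : l2norm x ^+ 2 = \sum_(i < k) x i 0 ^+ 2.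
Proof. by rewrite sqr_sqrtr// sumr_ge0// => i _; exact: sqr_ge0. Qed.

Lemma l2norm_sqrE k (x : 'cV[R]_k) : l2norm x ^+ 2 = (x^T *m x) 0 0.
Proof. by rewrite l2norm_sqr mxE; apply: eq_bigr => i _; rewrite mxE expr2. Qed.

Lemma l2norm_sqrZ k (a : R) (x : 'cV[R]_k) : l2norm (a *: x) ^+ 2 = a ^+ 2 * l2norm x ^+ 2.
Proof. by rewrite !l2norm_sqr mulr_sumr; apply: eq_bigr => i _; rewrite mxE exprMn. Qed.

Lemma l2norm_sqrN k (x : 'cV[R]_k) : l2norm (- x) ^+ 2 = l2norm x ^+ 2.
Proof. by rewrite -scaleN1r l2norm_sqrZ sqrrN expr1n mul1r. Qed.

Lemma l2norm_sqrD_le k (eta : R) (x y : 'cV[R]_k) : 0 < eta ->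
  l2norm (x + y) ^+ 2 <= (1 + eta) * l2norm x ^+ 2 + (1 + eta^-1) * l2norm y ^+ 2.
Proof.
move=> eta0; rewrite !l2norm_sqr !mulr_sumr -big_split/=; apply: ler_sum => i _.
rewrite mxE -subr_ge0.
rewrite (_ : _ - _ = eta * (x i 0 - eta^-1 * y i 0) ^+ 2).
  by rewrite mulr_ge0 ?sqr_ge0// ltW.
by field; rewrite gt_eqF.
Qed.

Lemma centeringE k (x : 'cV[R]_k) :
  centering R k *m x = x - (k%:R^-1 * ((ones R k)^T *m x) 0 0) *: ones R k.
Proof.
rewrite /centering mulmxBl mul1mx -scalemxAl -mulmxA.
by set q := _^T *m x; rewrite {1}[q]mx11_scalar mul_mx_scalar scalerA.
Qed.

Lemma mean_ones k (x : 'cV[R]_k) : ((ones R k)^T *m x) 0 0 = \sum_(i < k) x i 0.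
Proof. by rewrite mxE; apply: eq_bigr => i _; rewrite !mxE mul1r. Qed.

(** Centering lowers the squared norm by s^2 / k, with s the sum of the coordinates; dimension 0 is
    set apart because of the division by k. *)
Lemma l2norm_centering_le k (x : 'cV[R]_k) :
  l2norm (centering R k *m x) ^+ 2 <= l2norm x ^+ 2.
Proof.
case: k x => [|k] x; first by rewrite !l2norm_sqr !big_ord0.
rewrite centeringE mean_ones; set s := \sum_i x i 0.
rewrite l2norm_sqr (eq_bigr (fun i => x i 0 ^+ 2 -
  (2 * (k.+1%:R^-1 * s)) * x i 0 + (k.+1%:R^-1 * s) ^+ 2)); last first.
  by move=> i _; rewrite !mxE; ring.
rewrite big_split/= sumrB -mulr_sumr -/s sumr_const card_ord -l2norm_sqr -subr_ge0.
rewrite (_ : _ - _ = k.+1%:R^-1 * s ^+ 2); first by rewrite mulr_ge0 ?sqr_ge0.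
by rewrite -mulr_natr; field; rewrite nat1r pnatr_eq0.
Qed.

(** This and [m_0E] give both shrinkage maps the same shape, with Q the centering or the identity
    matrix, so that one risk bound serves both. *)
Lemma m_aE k (sigma : R) (x : 'cV[R]_k) :
  m_a sigma x =
  x - ((k%:R - 3) * sigma ^+ 2 / l2norm (centering R k *m x) ^+ 2) *: (centering R k *m x).
Proof.
rewrite /m_a -centeringE scalerBl scale1r addrA; congr (_ - _).
by rewrite centeringE addrCA subrr addr0.
Qed.

Lemma m_0E k (sigma : R) (x : 'cV[R]_k) :
  m_0 sigma x =
  x - ((k%:R - 2) * sigma ^+ 2 / l2norm (1%:M *m x) ^+ 2) *: (1%:M *m x).
Proof. by rewrite /m_0 mul1mx scalerBl scale1r. Qed.

Let lift01 k : lift ord0 ord0 = inord 1 :> 'I_k.+4.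
Proof. by apply/val_inj; rewrite /= inordK. Qed.

Let lift02 k : lift ord0 (lift ord0 ord0) = inord 2 :> 'I_k.+4.
Proof. by apply/val_inj; rewrite /= inordK. Qed.

Let lift03 k : lift ord0 (lift ord0 (lift ord0 ord0)) = inord 3 :> 'I_k.+4.
Proof. by apply/val_inj; rewrite /= inordK. Qed.

Definition col4 k (s0 s1 s2 s3 : R) : 'cV[R]_k.+4 :=
  \col_i nth 0 [:: s0; s1; s2; s3] i.

Lemma col4_dot k s0 s1 s2 s3 (x : 'cV[R]_k.+4) :
  ((col4 k s0 s1 s2 s3)^T *m x) 0 0 =
  s0 * x 0 0 + s1 * x (inord 1) 0 + s2 * x (inord 2) 0 + s3 * x (inord 3) 0.
Proof.
rewrite mxE !big_ord_recl big1 => [|i _]; last by rewrite !mxE/= nth_nil mul0r.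
by rewrite !mxE/= addr0 lift01 lift02 lift03 !addrA.
Qed.

Lemma l2norm_col4 k s0 s1 s2 s3 :
  l2norm (col4 k s0 s1 s2 s3) ^+ 2 = s0 ^+ 2 + s1 ^+ 2 + s2 ^+ 2 + s3 ^+ 2.
Proof. by rewrite l2norm_sqrE col4_dot !mxE/= !inordK// !expr2. Qed.

(** The range of the centering projection has dimension k - 1 >= 3, which is where dimension 4
    enters. Three orthonormal vectors orthogonal to [ones] see x only through its centered part, so
    the inequality is Bessel's. *)
Lemma orthonormal_triple_centering k : (4 <= k)%N ->
  exists a1 a2 a3 : 'cV[R]_k,
    (forall u1 u2 u3, l2norm (u1 *: a1 + u2 *: a2 + u3 *: a3) ^+ 2 =
      u1 ^+ 2 + u2 ^+ 2 + u3 ^+ 2) /\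
    (forall x, ((a1^T *m x) 0 0) ^+ 2 + ((a2^T *m x) 0 0) ^+ 2 +
      ((a3^T *m x) 0 0) ^+ 2 <= l2norm (centering R k *m x) ^+ 2).
Proof.
case: k => [|[|[|[|k]]]]// _.
(* The nonconstant rows of the normalized Hadamard matrix of order 4. *)
exists (col4 k 2^-1 2^-1 (- 2^-1) (- 2^-1)), (col4 k 2^-1 (- 2^-1) 2^-1 (- 2^-1)),
  (col4 k 2^-1 (- 2^-1) (- 2^-1) 2^-1); split=> [u1 u2 u3|x].
  rewrite (_ : _ + _ + _ = col4 k ((u1 + u2 + u3) / 2) ((u1 - u2 - u3) / 2)
      ((u2 - u1 - u3) / 2) ((u3 - u1 - u2) / 2)).
    by rewrite l2norm_col4; field.
  by apply/colP => i; rewrite !mxE; case: i => -[|[|[|[|i]]]] iP /=; rewrite ?nth_nil; field.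
pose b := k.+4%:R^-1 * ((ones R k.+4)^T *m x) 0 0.
have yE i : (centering R k.+4 *m x) i 0 = x i 0 - b 
  by rewrite centeringE -/b; move: b => b; rewrite !mxE mulr1.
rewrite !col4_dot l2norm_sqr !big_ord_recl.
set t := \sum_(i < k) _; have : 0 <= t by apply: sumr_ge0 => i _; exact: sqr_ge0.
rewrite !yE lift01 lift02 lift03.
set y0 := x _ 0; set y1 := x _ 0; set y2 := x _ 0; set y3 := x _ 0 => t0.
(* By Parseval for the order 4 Hadamard basis, what is left is the squared component along (1,1,1,1)
   / 2 of the first four centered coordinates, plus the tail [t]. *)
rewrite -subr_ge0 (_ : _ - _ = ((y0 + y1 + y2 + y3) / 2 - 2 * b) ^+ 2 + t); last by field.
by rewrite addr_ge0 ?sqr_ge0.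
Qed.

End SquaredNorm.

(** * Multivariate normal vectors and shrinkage *)

Section MultivariateNormal.
Context {R : realType} d (T : measurableType d) (P : probability T R).
Variables (k : nat) (Z : T -> 'cV[R]_k) (sigma : R).
Hypothesis sigma0 : 0 < sigma.
Hypothesis HZ : multivariate_normal P Z 0 (sigma ^+ 2 *: 1%:M).
Lemma measurable_mvn_dot (a : 'cV[R]_k) : measurable_fun [set: T] (fun w => (a^T *m Z w) 0 0).
Proof. by have [] := HZ a. Qed.

Lemma mvn_dot_std (a : 'cV[R]_k) : sigma ^+ 2 * l2norm a ^+ 2 = 1 ->
  forall B, measurable B ->
    P ((fun w => (a^T *m Z w) 0 0) @^-1` B) = normal_prob 0 1 B.
Proof.
move=> a1 B mB; have [_ /(_ B mB) PB] := HZ a.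
have vE : (a^T *m (sigma ^+ 2 *: 1%:M) *m a) 0 0 = 1.
  by rewrite -scalemxAr mulmx1 -scalemxAl mxE -l2norm_sqrE a1.
rewrite [LHS]PB vE mulmx0 mxE /normal_law.
by rewrite oner_eq0 sqrtr1.
Qed.

(** Divided by sigma |v|, the linear form is standard normal; when v = 0 the bound is 1 and is
    checked directly. *)
Lemma mvn_charfun_le (v : 'cV[R]_k) c :
  `|\int[P]_w cos (c + (v^T *m Z w) 0 0)| <= expR (- (sigma ^+ 2 * l2norm v ^+ 2 / 2)).
Proof.
have mcos : measurable_fun [set: T] (fun w => cos (c + (v^T *m Z w) 0 0)).
  apply: measurable_funcos.
  by apply: measurable_funD => //; exact: measurable_mvn_dot.
have [v0|v0] := eqVneq (l2norm v) 0.
  rewrite v0 expr0n/= mulr0 mul0r oppr0 expR0.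
  have icos : P.-integrable [set: T] (EFin \o (fun w => cos (c + (v^T *m Z w) 0 0))).
    apply: (@bounded_integrable_probability _ _ _ _ _ 1) => // w.
    exact: norm_cos_le1.
  apply: le_trans (le_normr_Rintegral measurableT icos) _.
  apply: (@le_trans _ _ (\int[P]_w 1)).
    apply: le_Rintegral => //.
    - by have := integrable_abse icos; apply: eq_integrable.
    - exact: finite_measure_integrable_cst.
    - by move=> w _; rewrite ler_norml cos_geN1 cos_le1.
  by rewrite Rintegral_cst// [X in fine X]probability_setT mulr1.
have sv0 : sigma * l2norm v != 0 by rewrite mulf_neq0// gt_eqF.
pose a := (sigma * l2norm v)^-1 *: v.
have a1 : sigma ^+ 2 * l2norm a ^+ 2 = 1.
  by rewrite l2norm_sqrZ mulrCA -exprMn -exprMn mulVf// expr1n.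
have := Rexpectation_cos_std_normal _ _ _ _ (measurable_mvn_dot a)
  (mvn_dot_std a a1) c (sigma * l2norm v).
have aE w : sigma * l2norm v * (a^T *m Z w) 0 0 = (v^T *m Z w) 0 0.
  by rewrite /a linearZ/= -scalemxAl mxE mulrA mulfV// mul1r.
under eq_Rintegral do rewrite aE.
move=> ->; rewrite exprMn normrM (ger0_norm (expR_ge0 _)) ler_piMl ?expR_ge0//.
exact: norm_cos_le1.
Qed.

Lemma delta_dot (i : 'I_k) (x : 'cV[R]_k) : ((delta_mx i 0 : 'cV[R]_k)^T *m x) 0 0 = x i 0.
Proof. by rewrite trmx_delta -rowE mxE. Qed.

Lemma measurable_mvn_coord i : measurable_fun [set: T] (fun w => Z w i 0).
Proof.
have := measurable_mvn_dot (delta_mx i 0).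
by under eq_fun do rewrite delta_dot.
Qed.

Lemma mvn_second_moment : (\int[P]_w (l2norm (Z w) ^+ 2)%:E = (sigma ^+ 2 * k%:R)%:E)%E.
Proof.
have E1 i : (\int[P]_w ((Z w i 0) ^+ 2)%:E = (sigma ^+ 2)%:E)%E.
  pose a : 'cV[R]_k := sigma^-1 *: delta_mx i 0.
  have a1 : sigma ^+ 2 * l2norm a ^+ 2 = 1.
    rewrite l2norm_sqrZ l2norm_sqrE delta_dot mxE !eqxx mulr1 -exprMn mulfV ?expr1n//.
    by rewrite gt_eqF.
  have := expectation_sqr_std_normal _ _ _ _ (measurable_mvn_dot a) (mvn_dot_std a a1).
  have ZE w : (Z w i 0) ^+ 2 = sigma ^+ 2 * ((a^T *m Z w) 0 0) ^+ 2.
    rewrite /a linearZ/= -scalemxAl mxE delta_dot exprMn mulrA -exprMn mulfV ?gt_eqF//.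
    by rewrite expr1n mul1r.
  under [in X in _ -> X]eq_integral do rewrite ZE EFinM.
  rewrite ge0_integralZl//; first by move=> ->; rewrite mule1.
  - by apply/measurable_EFinP/measurable_funX; exact: measurable_mvn_dot.
  - by move=> w _; rewrite lee_fin sqr_ge0.
  - by rewrite lee_fin sqr_ge0.
under eq_integral do rewrite l2norm_sqr -sumEFin.
rewrite ge0_integral_sum//; last 2 first.
- by move=> i; apply/measurable_EFinP/measurable_funX; exact: measurable_mvn_coord.
- by move=> i w _; rewrite lee_fin sqr_ge0.
by under eq_bigr do rewrite E1; rewrite sumEFin sumr_const card_ord mulr_natr.
Qed.

End MultivariateNormal.

(* Shared by the identity (for M_JS0) and the centering projections (for M_JS and
   M_rJS). *)
Definition rank3_contraction {R : realType} {k : nat} (Q : 'M[R]_k) : Prop :=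
  (forall x : 'cV[R]_k, l2norm (Q *m x) ^+ 2 <= l2norm x ^+ 2) /\
  exists a1 a2 a3 : 'cV[R]_k,
    (forall u1 u2 u3, l2norm (u1 *: a1 + u2 *: a2 + u3 *: a3) ^+ 2 =
      u1 ^+ 2 + u2 ^+ 2 + u3 ^+ 2) /\
    (forall x, ((a1^T *m x) 0 0) ^+ 2 + ((a2^T *m x) 0 0) ^+ 2 +
      ((a3^T *m x) 0 0) ^+ 2 <= l2norm (Q *m x) ^+ 2).

Lemma rank3_contraction_centering (R : realType) k : (4 <= k)%N ->
  rank3_contraction (centering R k).
Proof.
by move=> k4; split; [exact: l2norm_centering_le|exact: orthonormal_triple_centering].
Qed.

Lemma rank3_contraction1 (R : realType) k : (4 <= k)%N ->
  rank3_contraction (1%:M : 'M[R]_k).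
Proof.
move=> k4; split=> [x|]; first by rewrite mul1mx.
have [a1 [a2 [a3 [on le3]]]] := orthonormal_triple_centering (R := R) k k4.
exists a1, a2, a3; split=> // x.
by rewrite mul1mx (le_trans (le3 x))// l2norm_centering_le.
Qed.

Lemma measurable_l2norm_sqr (R : realType) d (T : measurableType d) k (f : T -> 'cV[R]_k) :
  (forall i, measurable_fun [set: T] (fun w => f w i 0)) ->
  measurable_fun [set: T] (fun w => l2norm (f w) ^+ 2).
Proof.
move=> mf; under eq_fun do rewrite l2norm_sqr.
by apply: measurable_sum => i; exact: measurable_funX.
Qed.

Lemma measurable_mulmx_coord (R : realType) d (T : measurableType d) k l
    (Q : 'M[R]_(l, k)) (f : T -> 'cV[R]_k) :
  (forall i, measurable_fun [set: T] (fun w => f w i 0)) ->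
  forall i, measurable_fun [set: T] (fun w => (Q *m f w) i 0).
Proof.
move=> mf i; under eq_fun do rewrite mxE.
by apply: measurable_sum => j; exact: measurable_funM.
Qed.

(** The inverse moment bound is applied in units of sigma: the Y are the three coordinates of theta
    + Z, D is |Q (theta + Z)|^2, N is |Z|^2 and m2 is |Q theta|^2. *)
Lemma mvn_inverse_moment_small (R : realType) (eps : R) (p : nat) : 0 < eps ->
  exists M : R, forall d (T : measurableType d) (P : probability T R) k
      (Z : T -> 'cV[R]_k) (sigma : R) (theta : 'cV[R]_k) (Q : 'M[R]_k),
    0 < sigma -> multivariate_normal P Z 0 (sigma ^+ 2 *: 1%:M) -> (k <= p)%N ->
    rank3_contraction Q -> M <= l2norm (Q *m theta) ^+ 2 / sigma ^+ 2 ->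
    (\int[P]_w (sigma ^+ 2 / l2norm (Q *m (theta + Z w)) ^+ 2)%:E <= eps%:E)%E.
Proof.
move=> eps0; have [M HM] := inverse_moment_small R eps p eps0.
exists M => d T P k Z s th Q s0 HZ kp [Qle [a1 [a2 [a3 [on le3]]]]] Mle.
have s20 : 0 < s ^+ 2 by rewrite exprn_gt0.
pose Y (a : 'cV[R]_k) w := s^-1 * (a^T *m (th + Z w)) 0 0.
have YE (a : 'cV[R]_k) w : Y a w = s^-1 * (a^T *m th) 0 0 + s^-1 * (a^T *m Z w) 0 0.
  by rewrite /Y mulmxDr mxE mulrDr.
have mY a : measurable_fun [set: T] (Y a).
  rewrite (_ : Y a = fun w => s^-1 * (a^T *m th) 0 0 + s^-1 * (a^T *m Z w) 0 0); last first.
    by apply/funext => w; exact: YE.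
  by apply: measurable_funD => //; apply: measurable_funM => //; exact: measurable_mvn_dot HZ a.
have mZ i : measurable_fun [set: T] (fun w => Z w i 0) by exact: measurable_mvn_coord HZ i.
have mx i : measurable_fun [set: T] (fun w => (th + Z w) i 0).
  by under eq_fun do rewrite mxE; exact: measurable_funD.
under eq_integral do rewrite -[_ / _]invrK invf_div.
apply: (HM _ _ _ (Y a1) (Y a2) (Y a3) _ (fun w => l2norm (Z w) ^+ 2 / s ^+ 2)
  (l2norm (Q *m th) ^+ 2 / s ^+ 2) k%:R) => //.
- by apply: measurable_funM => //; apply: measurable_l2norm_sqr; exact: measurable_mulmx_coord.
- by apply: measurable_funM => //; exact: measurable_l2norm_sqr.
- move=> u1 u2 u3 c.
  (* The form in the Y is v^T (theta + Z); its mean joins the phase, and sigma^2 |v|^2 is the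
     squared length of u by orthonormality. *)
  pose v := s^-1 *: (u1 *: a1 + u2 *: a2 + u3 *: a3).
  have vE y : (v^T *m y) 0 0 =
      s^-1 * (u1 * (a1^T *m y) 0 0 + u2 * (a2^T *m y) 0 0 + u3 * (a3^T *m y) 0 0).
    rewrite !mxE !mulr_sumr -!big_split/= mulr_sumr; apply: eq_bigr => i _.
    by rewrite !mxE; ring.
  have e w : c + (u1 * Y a1 w + u2 * Y a2 w + u3 * Y a3 w) =
      c + (v^T *m th) 0 0 + (v^T *m Z w) 0 0.
    by rewrite !YE !vE; ring.
  under eq_Rintegral do rewrite e.
  apply: le_trans (mvn_charfun_le _ _ _ _ _ _ s0 HZ v _) _.
  by rewrite l2norm_sqrZ on exprVn mulrA mulfV ?mul1r// gt_eqF.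
- move=> w; rewrite /Y !exprMn -!mulrDr exprVn mulrC ler_pM2r ?invr_gt0//.
- by move=> w; rewrite divr_ge0 ?sqr_ge0.
- move=> w; rewrite -mulrDl mulrA ler_pM2r ?invr_gt0//.
  (* Write Q theta = Q (theta + Z) - Q Z, take weight 1 in the quadratic inequality, then contract
     |Q Z| to |Z|. *)
  have := @l2norm_sqrD_le _ k 1 (Q *m (th + Z w)) (- (Q *m Z w)) ltr01.
  rewrite -mulmxBr addrK l2norm_sqrN invr1 => h; apply: le_trans h _.
  by rewrite mulrDr lerD2l ler_pM2l.
- under eq_integral do rewrite mulrC EFinM.
  rewrite ge0_integralZl//; last 3 first.
  - by apply/measurable_EFinP; exact: measurable_l2norm_sqr.
  - by move=> w _; rewrite lee_fin sqr_ge0.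
  - by rewrite lee_fin invr_ge0 ltW.
  by rewrite (mvn_second_moment _ _ _ _ _ _ s0 HZ) -EFinM mulrA mulVf ?mul1r// gt_eqF.
- by rewrite ler0n ler_nat.
Qed.

(** Half of delta pays for eta |Z|^2 and half for the shift h. The threshold depends on p and delta
    only, so it is uniform over all dimensions k <= p and all c <= p. *)
Lemma shrinkage_risk_bounds (R : realType) (delta : R) (p : nat) : 0 < delta ->
  exists M : R, forall d (T : measurableType d) (P : probability T R) k
      (Z : T -> 'cV[R]_k) (sigma : R) (theta : 'cV[R]_k) (Q : 'M[R]_k) (c : R)
      (g : 'cV[R]_k -> 'cV[R]_k),
    (forall x, g x = x - (c * sigma ^+ 2 / l2norm (Q *m x) ^+ 2) *: (Q *m x)) ->
    0 < sigma -> multivariate_normal P Z 0 (sigma ^+ 2 *: 1%:M) -> (k <= p)%N ->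
    rank3_contraction Q -> 0 <= c <= p%:R ->
    M <= l2norm (Q *m theta) ^+ 2 / sigma ^+ 2 ->
    ((sigma ^+ 2 * (k%:R - delta))%:E <=
      \int[P]_w (l2norm (g (theta + Z w) - theta) ^+ 2)%:E <=
      (sigma ^+ 2 * (k%:R + delta))%:E)%E.
Proof.
move=> delta0.
(* This gives eta k <= delta / 2 for k <= p; the successor keeps the denominator positive. *)
pose eta := delta / 2 / (p.+1%:R).
have eta0 : 0 < eta by rewrite !divr_gt0.
(* [B] bounds (1 + 1 / eta) c^2, and [eps] is set so that B eps = delta / 2. *)
pose B := (1 + eta^-1) * p.+1%:R ^+ 2.
have B0 : 0 < B by rewrite mulr_gt0 ?exprn_gt0// addr_gt0 ?invr_gt0.
pose eps := delta / 2 / B.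
have eps0 : 0 < eps by rewrite !divr_gt0.
have [M HM] := mvn_inverse_moment_small R eps p eps0.
exists M => d T P k Z s th Q c g gE s0 HZ kp HQ /andP[c0 cp] Mle.
have s20 : 0 < s ^+ 2 by rewrite exprn_gt0.
have H1 := HM d T P k Z s th Q s0 HZ kp HQ Mle.
have H2 := mvn_second_moment _ _ _ _ _ _ s0 HZ.
pose x w := th + Z w.
pose q w := s ^+ 2 / l2norm (Q *m x w) ^+ 2.
pose h w := (c * s ^+ 2 / l2norm (Q *m x w) ^+ 2) *: (Q *m x w).
(* This also holds when Qx = 0, since then 1 / |Qx|^2 = 0. *)
have hE w : l2norm (h w) ^+ 2 = c ^+ 2 * s ^+ 2 * q w.
  rewrite /h l2norm_sqrZ /q; have [->|n0] := eqVneq (l2norm (Q *m x w)) 0.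
    by rewrite expr0n/= invr0 !mulr0.
  by field.
have gh w : g (th + Z w) - th = Z w - h w by rewrite gE /h /x addrAC [th + _]addrC addrK.
have q0 w : 0 <= q w by rewrite divr_ge0 ?sqr_ge0.
have mZ i : measurable_fun [set: T] (fun w => Z w i 0) by exact: measurable_mvn_coord HZ i.
have mx i : measurable_fun [set: T] (fun w => (x w) i 0).
  by under eq_fun do rewrite mxE; exact: measurable_funD.
have mq : measurable_fun [set: T] q.
  apply: measurable_funM => //; apply: measurable_funV; last by move=> w; exact: sqr_ge0.
  by apply: measurable_l2norm_sqr; exact: measurable_mulmx_coord.
have mh i : measurable_fun [set: T] (fun w => (Z w - h w) i 0).
  rewrite (_ : (fun _ => _) = fun w => Z w i 0 - c * q w * (Q *m x w) i 0); last first.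
    by apply/funext => w; rewrite !mxE /q mulrA.
  apply: measurable_funB => //; apply: measurable_funM; first exact: measurable_funM.
  exact: measurable_mulmx_coord.
under eq_integral do rewrite gh.
have mN : measurable_fun [set: T] (fun w => (l2norm (Z w) ^+ 2)%:E).
  by apply/measurable_EFinP; exact: measurable_l2norm_sqr.
have mL : measurable_fun [set: T] (fun w => (l2norm (Z w - h w) ^+ 2)%:E).
  by apply/measurable_EFinP; exact: measurable_l2norm_sqr.
have mq' : measurable_fun [set: T] (fun w => (q w)%:E) by exact/measurable_EFinP.
pose b := (1 + eta^-1) * (c ^+ 2 * s ^+ 2).
have b0 : 0 <= b by rewrite mulr_ge0 ?addr_ge0 ?invr_ge0 ?mulr_ge0 ?sqr_ge0// ltW.
have bq : (b%:E * \int[P]_w (q w)%:E <= (s ^+ 2 * (delta / 2))%:E)%E.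
  apply: (@le_trans _ _ (b%:E * eps%:E))%E; first by rewrite lee_wpmul2l ?lee_fin.
  have cp1 : c ^+ 2 <= p.+1%:R ^+ 2.
    by rewrite lerXn2r// ?nnegrE// (le_trans cp)// ler_nat.
  have bB : b <= s ^+ 2 * B.
    rewrite /b /B [leRHS]mulrCA [c ^+ 2 * _]mulrC.
    by rewrite ler_pM2l ?addr_gt0 ?invr_gt0// ler_pM2l.
  rewrite -EFinM lee_fin; apply: le_trans (ler_wpM2r (ltW eps0) bB) _.
  by rewrite -mulrA [B * _]mulrC divfK// gt_eqF.
(* Both quadratic inequalities are integrated through this one form, with |Z - h|^2 and |Z|^2 in
   either order. *)
have split_le (f1 f2 : T -> R) : measurable_fun [set: T] (fun w => (f1 w)%:E) ->
    measurable_fun [set: T] (fun w => (f2 w)%:E) ->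
    (forall w, 0 <= f1 w) -> (forall w, 0 <= f2 w) ->
    (forall w, f1 w <= (1 + eta) * f2 w + b * q w) ->
    (\int[P]_w (f1 w)%:E <= (1 + eta)%:E * \int[P]_w (f2 w)%:E + (s ^+ 2 * (delta / 2))%:E)%E.
  move=> mf1 mf2 f10 f20 f12.
  have e0 : 0 <= 1 + eta by rewrite addr_ge0// ltW.
  apply: (@le_trans _ _ (\int[P]_w ((1 + eta)%:E * (f2 w)%:E + b%:E * (q w)%:E)))%E.
    apply: ge0_le_integral => //.
    - by move=> w _; rewrite lee_fin.
    - by apply: emeasurable_funD; exact: measurable_funeM.
    - by move=> w _; rewrite -!EFinM -EFinD lee_fin.
  rewrite ge0_integralD//; last 4 first.
  - by move=> w _; rewrite mule_ge0 ?lee_fin.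
  - exact: measurable_funeM.
  - by move=> w _; rewrite mule_ge0 ?lee_fin.
  - exact: measurable_funeM.
  rewrite !ge0_integralZl//.
  - by rewrite leeD2l.
  - by move=> w _; rewrite lee_fin.
  - by move=> w _; rewrite lee_fin.

have ek : eta * k%:R <= delta / 2.
  rewrite /eta mulrAC ler_pdivrMr// ler_pM2l ?divr_gt0// ler_nat.
  exact: leq_trans kp _.
have opE : ((1 + eta)%:E * (s ^+ 2 * k%:R)%:E <= (s ^+ 2 * (k%:R + delta / 2))%:E)%E.
  by rewrite -EFinM lee_fin mulrCA ler_pM2l// mulrDl mul1r lerD2l.
have b_h w : (1 + eta^-1) * l2norm (h w) ^+ 2 = b * q w by rewrite hE /b !mulrA.
apply/andP; split; last first.
  apply: le_trans (split_le _ (fun w => l2norm (Z w) ^+ 2) mL mN _ _ _) _.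
  - by move=> w; exact: sqr_ge0.
  - by move=> w; exact: sqr_ge0.
  - by move=> w; rewrite -b_h -(l2norm_sqrN _ (h w)); exact: l2norm_sqrD_le.
  rewrite H2 (le_trans (leeD opE (lexx _)))// -EFinD lee_fin -mulrDr ler_pM2l//.
  lra.
have := split_le (fun w => l2norm (Z w) ^+ 2) (fun w => l2norm (Z w - h w) ^+ 2) mN mL.
rewrite H2 => H3.
have {H3} : ((s ^+ 2 * k%:R)%:E <= (1 + eta)%:E * \int[P]_w (l2norm (Z w - h w) ^+ 2)%:E +
    (s ^+ 2 * (delta / 2))%:E)%E.
  apply: H3 => w; rewrite ?sqr_ge0// -b_h.
  by rewrite -{1}(subrK (h w) (Z w)); exact: l2norm_sqrD_le.
have : (0 <= \int[P]_w (l2norm (Z w - h w) ^+ 2)%:E)%E.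
  by apply: integral_ge0 => w _; rewrite lee_fin sqr_ge0.
(* An infinite risk satisfies the lower bound trivially, so only a real value r remains. *)
case: (\int[P]_w _)%E => [r||]; rewrite ?leey// !lee_fin => r0.
move=> rle; rewrite leNgt; apply/negP => rlt.
(* If r were below s^2 (k - delta), then eta r <= s^2 delta / 2, hence s^2 k <= r + s^2 delta < s^2
   k, a contradiction. *)
have er : eta * r <= s ^+ 2 * (delta / 2).
  apply: le_trans (ler_wpM2l (ltW eta0) (ltW rlt)) _.
  rewrite mulrCA ler_pM2l//; apply: le_trans ek.
  by rewrite ler_pM2l// gerBl ltW.
have := sqr_ge0 s; lra.
Qed.

(** * Orthonormal bases and limits *)

Lemma limn_esup_le_near (R : realType) (u : nat -> \bar R) c :
  (\forall n \near \oo, (u n <= c)%E) -> (limn_esup u <= c)%E.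
Proof.
move=> uc; rewrite /limn_esup limf_esupE.
apply: (@le_trans _ _ (ereal_sup (u @` [set n | (u n <= c)%E]))).
  by apply: ereal_inf_lbound; exists [set n | (u n <= c)%E].
by apply: ge_ereal_sup => _ [n /= un <-].
Qed.

Lemma limn_einf_ge_near (R : realType) (u : nat -> \bar R) c :
  (\forall n \near \oo, (c <= u n)%E) -> (c <= limn_einf u)%E.
Proof.
move=> uc; rewrite /limn_einf leeNr; apply: limn_esup_le_near.
by apply: filterS uc => n; rewrite leeN2.
Qed.

Section OrthonormalBases.
Context {R : realType} {p k l : nat}.
Variables (U : 'M[R]_(p, k)) (U1 : 'M[R]_(p, l)) (A : set 'cV[R]_p).
Hypothesis HU : orthonormal_basis U (linear_span A).
Hypothesis HU1 : orthonormal_basis U1 (orthogonal_complement (linear_span A)).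

Lemma linear_span_colE m (V : 'M[R]_(p, m)) v :
  linear_span (range (fun j : 'I_m => col j V)) v -> exists c, v = V *m c.
Proof.
case=> r [c [a [aV ->]]].
exists (\sum_(i < r) c i *: delta_mx (projT1 (cid2 (aV i))) 0).
rewrite mulmx_sumr; apply: eq_bigr => i _.
by case: (cid2 _) => j /= _ <-; rewrite -scalemxAr colE.
Qed.

Lemma linear_span_col m (V : 'M[R]_(p, m)) (j : 'I_m) :
  linear_span (range (fun j : 'I_m => col j V)) (col j V).
Proof.
exists 1%N, (fun=> 1), (fun=> col j V); split; first by move=> _; exists j.
by rewrite big_ord1 scale1r.
Qed.

Lemma orthonormal_basis_complement_orth : U1^T *m U = 0.
Proof.
have [_ spU] := HU; have [_ spU1] := HU1.
apply/matrixP => i j; rewrite [RHS]mxE.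
have : orthogonal_complement (linear_span A) (col i U1).
  by rewrite -spU1; exact: linear_span_col.
move=> /(_ (col j U)); rewrite -[in X in X -> _]spU => /(_ (linear_span_col _ _ _)).
move=> <-; rewrite !mxE; apply: eq_bigr => q _; rewrite !mxE; exact: mulrC.
Qed.

(** The residual v - U U^T v lies in the orthogonal complement, so the projection U1 U1^T fixes it,
    while U1^T U = 0 removes the other part. *)
Lemma orthonormal_basis_resolution (v : 'cV[R]_p) : U1 *m U1^T *m v = v - U *m U^T *m v.
Proof.
have [UU spU] := HU; have [UU1 spU1] := HU1.
pose y := v - U *m U^T *m v.
have [c yE] : exists c, y = U1 *m c.
  apply: linear_span_colE; rewrite spU1 => u; rewrite -spU => /linear_span_colE[b ->].
  by rewrite trmx_mul /y mulmxBr !mulmxA -(mulmxA b^T _ U) UU mulmx1 subrr mxE.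
have yfix : U1 *m U1^T *m y = y by rewrite yE mulmxA -(mulmxA U1 _ U1) UU1 mulmx1.
rewrite -/y -[RHS]yfix /y mulmxBr !mulmxA -(mulmxA U1 _ U).
by rewrite orthonormal_basis_complement_orth mulmx0 !mul0mx subr0.
Qed.

End OrthonormalBases.

Lemma l2norm_isometry (R : realType) p k (U : 'M[R]_(p, k)) (x : 'cV[R]_k) :
  U^T *m U = 1%:M -> l2norm (U *m x) ^+ 2 = l2norm x ^+ 2.
Proof. by move=> UU; rewrite !l2norm_sqrE trmx_mul mulmxA -(mulmxA x^T) UU mulmx1. Qed.

(** A linear form a in U^T Z is the form U a in Z, with variance s |a|^2. The singular noise thus
    becomes nondegenerate in the k coordinates of the subspace. *)
Lemma mvn_isometry (R : realType) d (T : measurableType d) (P : probability T R)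
    p k (U : 'M[R]_(p, k)) (Z : T -> 'cV[R]_p) (s : R) :
  U^T *m U = 1%:M -> multivariate_normal P Z 0 (s *: (U *m U^T)) ->
  multivariate_normal P (fun w => U^T *m Z w) 0 (s *: 1%:M).
Proof.
move=> UU HZ a; have [mZ lawZ] := HZ (U *m a).
have dotE w : ((U *m a)^T *m Z w) 0 0 = (a^T *m (U^T *m Z w)) 0 0.
  by rewrite trmx_mul mulmxA.
split; first by rewrite -(funext dotE).
move=> B mB; transitivity (P [set w | B (((U *m a)^T *m Z w) 0 0)]).
  by congr (P _); apply/funext => w /=; rewrite dotE.
have varE : (U *m a)^T *m (s *: (U *m U^T)) *m (U *m a) = a^T *m (s *: 1%:M) *m a.
  rewrite trmx_mul -!scalemxAr -!scalemxAl mulmx1 !mulmxA.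
  by rewrite -(mulmxA a^T _ U) UU mulmx1 -(mulmxA a^T _ U) UU mulmx1.
have meanE : ((U *m a)^T *m 0 : 'M[R]_1) = a^T *m 0 by rewrite !mulmx0.
by rewrite (lawZ B mB) varE meanE.
Qed.

Lemma risk_scaled_bounds (R : realType) (s a b : R) (L : \bar R) : 0 < s ->
  ((s * a)%:E <= L <= (s * b)%:E)%E -> (a%:E <= L * s^-1%:E <= b%:E)%E.
Proof.
move=> s0 /andP[aL Lb].
rewrite (_ : a%:E = (s * a)%:E * s^-1%:E)%E; last first.
  by rewrite -EFinM mulrAC mulfV ?mul1r// gt_eqF.
rewrite (_ : b%:E = (s * b)%:E * s^-1%:E)%E; last first.
  by rewrite -EFinM mulrAC mulfV ?mul1r// gt_eqF.
by rewrite !lee_pmul2r ?lte_fin ?invr_gt0//= aL.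
Qed.

Lemma cvg_ratio_sqr_ge (R : realType) (a b s : nat -> R) (mu M : R) : 0 < mu ->
  (forall n, (0 < n)%N -> s n = b n / mu) ->
  a n / b n @[n --> \oo] --> +oo ->
  \forall n \near \oo, M <= a n ^+ 2 / s n ^+ 2.
Proof.
(* A ratio that is at least 1 is at most its square, so a lower bound M / mu^2 on it passes to the
   square. *)
move=> mu0 sE /cvgryPge /(_ (Num.max 1 (M / mu ^+ 2))) H; near=> n.
rewrite sE; last by near: n; exact: nbhs_infty_gt.
have : Num.max 1 (M / mu ^+ 2) <= a n / b n by near: n.
rewrite ge_max => /andP[r1 rM].
rewrite exprMn exprVn invfM invrK mulrA -exprVn -exprMn -ler_pdivrMr ?exprn_gt0//.
by rewrite (le_trans rM)// expr2 ler_peMr// (le_trans ler01).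
Unshelve. all: by end_near. Qed.

(** * ** Risks of the mechanisms and their comparison *)

Lemma risk_M_JS_bounds (R : realType) (delta : R) (p : nat) : 0 < delta ->
  exists M : R, forall d (T : measurableType d) (P : probability T R) (X : Type)
      (n : nat) (theta : n.-tuple X -> 'cV[R]_p) (sigma : R)
      (M_G : n.-tuple X -> T -> 'cV[R]_p) (S : n.-tuple X),
    0 < sigma -> (4 <= p)%N ->
    normal_mechanism P theta (sigma ^+ 2 *: 1%:M) M_G ->
    (M <= l2norm (theta S) ^+ 2 / sigma ^+ 2 ->
      ((p%:R - delta)%:E <=
      L2_risk P theta (M_JS0 sigma M_G) S * ((sigma ^+ 2)^-1)%:E)%E) /\
    (M <= l2norm (centering R p *m theta S) ^+ 2 / sigma ^+ 2 ->
      ((p%:R - delta)%:E <=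
      L2_risk P theta (M_JS sigma M_G) S * ((sigma ^+ 2)^-1)%:E)%E).
Proof.
move=> delta0; have [M HM] := shrinkage_risk_bounds R delta p delta0.
exists M => d T P X n theta s M_G S s0 p4 HG.
have s20 : 0 < s ^+ 2 by rewrite exprn_gt0.
have xE w : theta S + (M_G S w - theta S) = M_G S w by rewrite addrC subrK.
have pn i : (i <= 4)%N -> 0 <= (p%:R - i%:R : R) <= p%:R.
  by move=> i4; rewrite subr_ge0 ler_nat (leq_trans i4 p4) gerBl ler0n.
split=> Mle.
  rewrite -[theta S]mul1mx in Mle.
  have /risk_scaled_bounds := HM _ _ _ _ _ _ (theta S) _ _ _ (m_0E p s) s0 (HG S) (leqnn p)
    (rank3_contraction1 R p p4) (pn 2 isT) Mle.
  move=> /(_ s20) /andP[+ _].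
  by rewrite /L2_risk unlock; under eq_integral do rewrite xE.
have /risk_scaled_bounds := HM _ _ _ _ _ _ (theta S) _ _ _ (m_aE p s) s0 (HG S) (leqnn p)
    (rank3_contraction_centering R p p4) (pn 3 isT) Mle.
move=> /(_ s20) /andP[+ _].
by rewrite /L2_risk unlock; under eq_integral do rewrite xE.
Qed.

(** The error of [M_rJS] stays in the range of U, where it is the image of the error of [m_a] in
    dimension k, and U preserves norms. The threshold precedes k, since the dimension of the
    sensitivity space may vary with n. *)
Lemma risk_M_rJS_bounds (R : realType) (delta : R) (p : nat) : 0 < delta ->
  exists M : R, forall d (T : measurableType d) (P : probability T R) (X : Type)
      (n : nat) (theta : n.-tuple X -> 'cV[R]_p) (k l : nat)
      (U : 'M[R]_(p, k)) (U1 : 'M[R]_(p, l)) (sigma : R)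
      (M_r : n.-tuple X -> T -> 'cV[R]_p) (S : n.-tuple X),
    0 < sigma -> (4 <= k <= p)%N ->
    orthonormal_basis U (linear_span (sensitivity_space theta)) ->
    orthonormal_basis U1 (orthogonal_complement (linear_span (sensitivity_space theta))) ->
    normal_mechanism P theta (sigma ^+ 2 *: (U *m U^T)) M_r ->
    M <= l2norm (centering R k *m (U^T *m theta S)) ^+ 2 / sigma ^+ 2 ->
    (L2_risk P theta (M_rJS theta U U1 sigma M_r) S * ((sigma ^+ 2)^-1)%:E <=
      (k%:R + delta)%:E)%E.
Proof.
move=> delta0; have [M HM] := shrinkage_risk_bounds R delta p delta0.
exists M => d T P X n theta k l U U1 s M_r S s0 /andP[k4 kp] HU HU1 Hr Mle.
have s20 : 0 < s ^+ 2 by rewrite exprn_gt0.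
have [UU _] := HU.
have k3 : 0 <= (k%:R - 3 : R) <= p%:R.
  rewrite subr_ge0 ler_nat (leq_trans _ k4)//= (@le_trans _ _ k%:R) ?ler_nat//.
  by rewrite gerBl.
have HZ := mvn_isometry _ _ _ _ _ _ _ _ _ UU (Hr S).
have /risk_scaled_bounds := HM _ _ _ _ _ _ (U^T *m theta S) _ _ _ (m_aE k s) s0 HZ kp
    (rank3_contraction_centering R k k4) k3 Mle.
move=> /(_ s20) /andP[_].
rewrite /L2_risk unlock.
under eq_integral do rewrite -mulmxDr [theta S + _]addrC subrK -(l2norm_isometry _ _ _ _ _ UU).
congr (_ * _ <= _)%E; apply: eq_integral => w _; congr (_ ^+ 2)%:E; congr l2norm.
rewrite /M_rJS (orthonormal_basis_resolution _ _ _ HU HU1).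
by rewrite mulmxBr mulmxA addrAC (addrAC (theta S)) subrr sub0r addrC.
Qed.

Theorem corollary8 (R : realType) (X : Type) (mu : R) (p : nat)
    (theta : forall n : nat, n.-tuple X -> 'cV[R]_p)
    (sigma : nat -> R)
    (U_theta : forall n : nat, 'M[R]_(p, sens_dim (theta n)))
    (U_1 : forall n : nat, 'M[R]_(p, p - sens_dim (theta n)))
    (disp : nat -> measure_display)
    (Omega : forall n : nat, measurableType (disp n))
    (P : forall n : nat, probability (Omega n) R)
    (M_G M_r : forall n : nat, n.-tuple X -> Omega n -> 'cV[R]_p)
    (S : forall n : nat, n.-tuple X) :
  0 < mu ->
  (4 <= p)%N ->
  (forall n, (0 < n)%N ->
     (0 < sensitivity (theta n))%E /\ (sensitivity (theta n) < +oo)%E) ->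
  (forall n, (0 < n)%N -> sigma n = fine (sensitivity (theta n)) / mu) ->
  (forall n, (0 < n)%N ->
     (4 <= sens_dim (theta n))%N /\ (sens_dim (theta n) < p)%N) ->
  (forall n, (0 < n)%N ->
     orthonormal_basis (U_theta n)
       (linear_span (sensitivity_space (theta n)))) ->
  (forall n, (0 < n)%N ->
     orthonormal_basis (U_1 n)
       (orthogonal_complement (linear_span (sensitivity_space (theta n))))) ->
  (forall n, (0 < n)%N ->
     normal_mechanism (P n) (theta n) (sigma n ^+ 2 *: 1%:M) (M_G n)) ->
  (forall n, (0 < n)%N ->
     normal_mechanism (P n) (theta n)
       (sigma n ^+ 2 *: (U_theta n *m (U_theta n)^T)) (M_r n)) ->
  l2norm (theta n (S n)) / fine (sensitivity (theta n))
    @[n --> \oo] --> +oo ->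
  l2norm (centering R p *m theta n (S n)) / fine (sensitivity (theta n))
    @[n --> \oo] --> +oo ->
  l2norm (centering R (sens_dim (theta n)) *m
            ((U_theta n)^T *m theta n (S n))) / fine (sensitivity (theta n))
    @[n --> \oo] --> +oo ->
  (limn_esup (fun n : nat =>
     L2_risk (P n) (theta n)
       (M_rJS (theta n) (U_theta n) (U_1 n) (sigma n) (M_r n)) (S n)
     * ((sigma n ^+ 2)^-1)%:E) <
   limn_einf (fun n : nat =>
     L2_risk (P n) (theta n) (M_JS (sigma n) (M_G n)) (S n)
     * ((sigma n ^+ 2)^-1)%:E))%E
  /\
  (limn_esup (fun n : nat =>
     L2_risk (P n) (theta n)
       (M_rJS (theta n) (U_theta n) (U_1 n) (sigma n) (M_r n)) (S n)
     * ((sigma n ^+ 2)^-1)%:E) <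
   limn_einf (fun n : nat =>
     L2_risk (P n) (theta n) (M_JS0 (sigma n) (M_G n)) (S n)
     * ((sigma n ^+ 2)^-1)%:E))%E.
Proof.
move=> mu0 p4 sens sigE dimE HU HU1 HG Hr lim0 limc limr.
have sg0 n : (0 < n)%N -> 0 < sigma n.
  move=> n0; have [d0 dy] := sens n n0.
  by rewrite sigE// divr_gt0// fine_gt0// d0.
(* An error of 1/4 on each side fits in the gap between d_theta and p. *)
have q0 : 0 < 4^-1 :> R by rewrite invr_gt0.
have [M HM] := risk_M_JS_bounds R _ p q0.
have [M' HM'] := risk_M_rJS_bounds R _ p q0.
have E0 := cvg_ratio_sqr_ge _ _ _ sigma _ M mu0 sigE lim0.
have Ec := cvg_ratio_sqr_ge _ _ _ sigma _ M mu0 sigE limc.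
have Er := cvg_ratio_sqr_ge _ _ _ sigma _ M' mu0 sigE limr.
(* The dimension of the sensitivity space may vary with n, so the limit superior is compared with
   its largest possible value p - 1. *)
have sup_le : (limn_esup (fun n : nat =>
     L2_risk (P n) (theta n)
       (M_rJS (theta n) (U_theta n) (U_1 n) (sigma n) (M_r n)) (S n)
     * ((sigma n ^+ 2)^-1)%:E) <= (p.-1%:R + 4^-1)%:E)%E.
  apply: limn_esup_le_near; near=> n.
  have n0 : (0 < n)%N by near: n; exact: nbhs_infty_gt.
  have [k4 kp] := dimE n n0.
  apply: (@le_trans _ _ ((sens_dim (theta n))%:R + 4^-1)%:E).
    apply: HM'; rewrite ?sg0 ?k4 ?(ltnW kp)//; [exact: HU|exact: HU1|exact: Hr|].
    by near: n.
  by rewrite lee_fin lerD2r ler_nat -ltnS prednK// (leq_trans _ p4).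
have lt_p : ((p.-1%:R + 4^-1)%:E < (p%:R - 4^-1)%:E :> \bar R)%E.
  have -> : p%:R = p.-1%:R + 1 :> R by rewrite natr1 prednK// (leq_trans _ p4).
  rewrite lte_fin; lra.
split; apply: le_lt_trans sup_le (lt_le_trans lt_p _); apply: limn_einf_ge_near; near=> n.
- have n0 : (0 < n)%N by near: n; exact: nbhs_infty_gt.
  apply: (HM _ _ _ _ _ _ _ _ _ (sg0 n n0) p4 (HG n n0)).2.
  by near: n.
- have n0 : (0 < n)%N by near: n; exact: nbhs_infty_gt.
  apply: (HM _ _ _ _ _ _ _ _ _ (sg0 n n0) p4 (HG n n0)).1.
  by near: n.
Unshelve. all: by end_near. Qed.
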